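(* The countable models of set theory are linearly pre-ordered by embeddability: if $\langle M,\in^M\rangle$ and $\langle N,\in^N\rangle$ are countable models of set theory, then either $M$ is isomorphic to a submodel of $N$ or $N$ is isomorphic to a submodel of $M$. Indeed, the countable models of set theory are pre-well-ordered by embeddability in order type exactly $\omega_1+1$; that is, the bi-embeddability classes of countable models of set theory, ordered by embeddability, form a well-order of order type exactly $\omega_1+1$.
   Context: A model of set theory is a first-order structure $\langle M,\in^M\rangle$ in the language with one binary relation symbol that satisfies at least the axioms of Kripke–Platek set theory KP; it need not be well-founded or transitive. A submodel of $\langle N,\in^N\rangle$ is an arbitrary subset of $N$ with the restriction of $\in^N$ (an induced substructure, not required to satisfy any axioms). $M$ is embeddable into $N$ if $M$ is isomorphic to a submodel of $N$, i.e. there is an injective $j:M\to N$ with $x\in^M y\iff j(x)\in^N j(y)$. Two models are bi-embeddable if each is embeddable into the other. *)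

(* Defs.v *)
From mathcomp Require Import all_boot.
From mathcomp Require Import boolp classical_sets functions cardinality wochoice.

Set Implicit Arguments.
Unset Strict Implicit.
Unset Printing Implicit Defensive.

Local Open Scope classical_set_scope.

Record structure := Structure {
  carrier :> Type;
  mem_in : carrier -> carrier -> Prop }.

Arguments mem_in {s} x y.

(* First-order formulas of the language of set theory, with de Bruijn indices:
   the quantifiers bind index 0. *)
Inductive formula :=
| FMem of nat & nat
| FEq of nat & nat
| FBot
| FAnd of formula & formula
| FOr of formula & formula
| FImp of formula & formula
| FAll of formula
| FEx of formula.

Definition scons (T : Type) (x : T) (e : nat -> T) : nat -> T :=
  fun n => if n is m.+1 then e m else x.

Fixpoint sat (M : structure) (phi : formula) (e : nat -> M) : Prop :=
  match phi with
  | FMem i j => mem_in (e i) (e j)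
  | FEq i j => e i = e j
  | FBot => False
  | FAnd p q => sat p e /\ sat q e
  | FOr p q => sat p e \/ sat q e
  | FImp p q => sat p e -> sat q e
  | FAll p => forall x : M, sat p (scons x e)
  | FEx p => exists x : M, sat p (scons x e)
  end.

(* The bound in a bounded quantifier is [i.+1], i.e. the variable [i] of the
   surrounding context: the quantified variable cannot bound itself. *)
Inductive Delta0 : formula -> Prop :=
| Delta0_mem i j : Delta0 (FMem i j)
| Delta0_eq i j : Delta0 (FEq i j)
| Delta0_bot : Delta0 FBot
| Delta0_and p q : Delta0 p -> Delta0 q -> Delta0 (FAnd p q)
| Delta0_or p q : Delta0 p -> Delta0 q -> Delta0 (FOr p q)
| Delta0_imp p q : Delta0 p -> Delta0 q -> Delta0 (FImp p q)
| Delta0_all i p : Delta0 p -> Delta0 (FAll (FImp (FMem 0 i.+1) p))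
| Delta0_ex i p : Delta0 p -> Delta0 (FEx (FAnd (FMem 0 i.+1) p)).

(* Kripke-Platek set theory (Barwise): foundation is the scheme for all
   formulas, and infinity is not an axiom.  Parameters of the schemes are the
   values of the environment [e]. *)
Record models_KP (M : structure) : Prop := ModelsKP {
  KP_nonempty : inhabited M;
  KP_extensionality : forall x y : M,
    (forall z : M, mem_in z x <-> mem_in z y) -> x = y;
  KP_foundation : forall (phi : formula) (e : nat -> M),
    (exists x : M, sat phi (scons x e)) ->
    exists x : M, sat phi (scons x e) /\
      forall y : M, mem_in y x -> ~ sat phi (scons y e);
  KP_pairing : forall x y : M, exists z : M, mem_in x z /\ mem_in y z;
  KP_union : forall a : M, exists b : M,
    forall x y : M, mem_in x a -> mem_in y x -> mem_in y b;
  KP_Delta0_separation : forall phi : formula, Delta0 phi ->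
    forall (e : nat -> M) (a : M), exists b : M,
    forall x : M, mem_in x b <-> mem_in x a /\ sat phi (scons x e);
  KP_Delta0_collection : forall phi : formula, Delta0 phi ->
    forall (e : nat -> M) (a : M),
    (forall x : M, mem_in x a -> exists y : M, sat phi (scons y (scons x e))) ->
    exists b : M, forall x : M, mem_in x a ->
      exists y : M, mem_in y b /\ sat phi (scons y (scons x e)) }.

Definition embeddable (M N : structure) : Prop :=
  exists j : M -> N, injective j /\
    forall x y : M, mem_in x y <-> mem_in (j x) (j y).

Definition biembeddable (M N : structure) : Prop :=
  embeddable M N /\ embeddable N M.

Record countable_model := CountableModel {
  model_structure :> structure;
  model_KP : models_KP model_structure;
  model_countable : countable [set: model_structure] }.

Definition embeds : rel countable_model := fun M N => `[< embeddable M N >].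

Definition biembed_class (M : countable_model) : set countable_model :=
  [set N : countable_model | biembeddable M N].

Definition biembed_classes : Type :=
  {C : set countable_model | range biembed_class C}.

Definition class_le : rel biembed_classes := fun C D =>
  `[< exists M N : countable_model, [/\ sval C M, sval D N & embeddable M N] >].

(* The well-orders of type omega_1, the least uncountable ordinal: those that
   are uncountable while all their proper initial segments are countable. *)
Definition is_omega1 (W : Type) (le : rel W) : Prop :=
  [/\ well_order le, ~ countable [set: W] &
      forall w : W, countable [set v : W | le v w /\ v <> w]].

(* The order on W + 1, with [None] added on top. *)
Definition succ_le (W : Type) (le : rel W) : rel (option W) := fun x y =>
  match x, y with
  | Some v, Some w => le v w
  | _, None => true
  | None, Some _ => false
  end.

Definition order_isomorphic (S T : Type) (leS : rel S) (leT : rel T) : Prop :=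
  exists f : S -> T, bijective f /\ forall x y : S, leS x y = leT (f x) (f y).

Definition has_order_type_omega1_plus_1 (T : Type) (leT : rel T) : Prop :=
  exists (W : Type) (leW : rel W),
    is_omega1 leW /\ order_isomorphic leT (succ_le leW).

(* Main.v *)
(**
Say that t is rich over s when t includes s and contains x ∪ {y} for x, y in s
and {z in s | l in z} for l in s.  If the elements a of a countable structure A
receive chains t_a(0), t_a(1), ... in a model M of KP, each set rich over the
previous one, such that t_b(0) is rich over every t_a(n) when a ∈ b, then A
embeds in M: enumerating A, each image is fixed from finitely many earlier ones,
and later elements enter it because they carry its label.

If M is ill-founded, say g_0 ∋ g_1 ∋ ..., call the gap between s and t g-wide
when for each d in g it splits into two d-wide ones.  Wide gaps exist by
∈-induction in M, and the g_n make being g_n-wide for some n a dense order.  Any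
countable acyclic relation maps into a dense order, so M is universal.

If M is well-founded, a Σ_1 recursion on rank yields a tower of rich sets as
tall as M, so that a countable structure embeds in M as soon as its height is at
most that of M; models all of whose elements are finite are handled directly.
Hence well-founded models are classified by their height and ill-founded ones
form a single class on top.  There are uncountably many heights because
the hereditarily small sets form a well-founded model of KP, whose countable
hulls can be made higher than any countable family of countable well-founded
models; the top class is inhabited by a hull of an ultrapower.
*)

From Stdlib Require List.
From Stdlib Require Import Relation_Operators Operators_Properties Transitive_Closure.
Require Import Defs.
From mathcomp Require Import all_boot.
From mathcomp Require Import boolp classical_sets functions cardinality wochoice.
From mathcomp Require Import filter.

Set Implicit Arguments.
Unset Strict Implicit.
Unset Printing Implicit Defensive.

(** * Definability and set theory in models of KP *)

Local Notation "x '∈' y" := (mem_in x y) (at level 70).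
Local Notation "x '∉' y" := (~ mem_in x y) (at level 70).

Section Definability.
Variable M : structure.
Implicit Types (P Q : (nat -> M) -> Prop) (S : (nat -> M) -> M -> Prop).

(** Definability is stated for predicates on environments, so that the closure lemmas find the
    formula by proof search along the shape of the predicate. *)
Definition D0 P := exists2 phi, Delta0 phi & forall e, sat phi e <-> P e.
Definition Df P := exists phi, forall e : nat -> M, sat phi e <-> P e.

Lemma D0_mem i j : D0 (fun e => e i ∈ e j).
Proof. by exists (FMem i j); first exact: Delta0_mem. Qed.

Lemma D0_eq i j : D0 (fun e => e i = e j).
Proof. by exists (FEq i j); first exact: Delta0_eq. Qed.

Lemma D0_and P Q : D0 P -> D0 Q -> D0 (fun e => P e /\ Q e).
Proof.
move=> [p dp hp] [q dq hq]; exists (FAnd p q); first exact: Delta0_and.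
by move=> e /=; rewrite hp hq.
Qed.

Lemma D0_or P Q : D0 P -> D0 Q -> D0 (fun e => P e \/ Q e).
Proof.
move=> [p dp hp] [q dq hq]; exists (FOr p q); first exact: Delta0_or.
by move=> e /=; rewrite hp hq.
Qed.

Lemma D0_imp P Q : D0 P -> D0 Q -> D0 (fun e => P e -> Q e).
Proof.
move=> [p dp hp] [q dq hq]; exists (FImp p q); first exact: Delta0_imp.
by move=> e /=; rewrite hp hq.
Qed.

Lemma D0_false : D0 (fun=> False).
Proof. by exists FBot; first exact: Delta0_bot. Qed.

Lemma D0_all S i : D0 (fun e => S (fun k => e k.+1) (e 0)) ->
  D0 (fun e => forall x, x ∈ e i -> S e x).
Proof.
move=> [p dp hp]; exists (FAll (FImp (FMem 0 i.+1) p)); first exact: Delta0_all.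
have hp' e x : sat p (scons x e) <-> S e x := hp (scons x e).
by move=> e; split=> h x /(h x) /hp'.
Qed.

Lemma D0_ex S i : D0 (fun e => S (fun k => e k.+1) (e 0)) ->
  D0 (fun e => exists x, x ∈ e i /\ S e x).
Proof.
move=> [p dp hp]; exists (FEx (FAnd (FMem 0 i.+1) p)); first exact: Delta0_ex.
have hp' e x : sat p (scons x e) <-> S e x := hp (scons x e).
by move=> e; split=> -[x [hx /hp' hS]]; exists x.
Qed.

Lemma Df_D0 P : D0 P -> Df P.
Proof. by move=> [p _ hp]; exists p. Qed.

Lemma Df_not P : Df P -> Df (fun e => ~ P e).
Proof. by move=> [p hp]; exists (FImp p FBot) => e /=; rewrite hp. Qed.

Lemma Df_all S : Df (fun e => S (fun k => e k.+1) (e 0)) ->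
  Df (fun e => forall x, S e x).
Proof.
move=> [p hp]; exists (FAll p) => e.
have hp' e x : sat p (scons x e) <-> S e x := hp (scons x e).
by split=> h x; apply/hp'/h.
Qed.

Lemma Df_ex S : Df (fun e => S (fun k => e k.+1) (e 0)) ->
  Df (fun e => exists x, S e x).
Proof.
move=> [p hp]; exists (FEx p) => e.
have hp' e x : sat p (scons x e) <-> S e x := hp (scons x e).
by split=> -[x /hp' hS]; exists x.
Qed.

End Definability.

(* A bounded quantifier is [forall x, x ∈ a -> _] or [exists x, x ∈ a /\ _],
   so these steps must come before the ones for [->] and [/\]. *)
Ltac d0_step := cbv beta; first
  [ apply: D0_mem | apply: D0_eq | apply: D0_false
  | apply: D0_all | apply: D0_ex | apply: D0_and | apply: D0_or | apply: D0_imp ].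

Section Predicates.
Variable M : structure.
Implicit Types x y z s t u p q : M.

Definition is_ins z x y :=
  (forall u, u ∈ z -> u ∈ x \/ u = y) /\ (forall u, u ∈ x -> u ∈ z) /\ y ∈ z.

Definition is_sel d s l :=
  (forall z, z ∈ d -> z ∈ s /\ l ∈ z) /\ (forall z, z ∈ s -> l ∈ z -> z ∈ d).

Definition subs s t := forall x, x ∈ s -> x ∈ t.

Definition rich s t :=
  subs s t /\
  (forall x, x ∈ s -> forall y, y ∈ s -> exists z, z ∈ t /\ is_ins z x y) /\
  (forall l, l ∈ s -> exists d, d ∈ t /\ is_sel d s l).

(** These are the elements forced into every set rich over [s]; see [richP]. *)
Definition step u s :=
  u ∈ s \/ (exists x, x ∈ s /\ exists y, y ∈ s /\ is_ins u x y) \/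
  exists l, l ∈ s /\ is_sel u s l.

Definition is_upair p x y := x ∈ p /\ y ∈ p /\ forall u, u ∈ p -> u = x \/ u = y.

Definition is_pair p x y := exists a, a ∈ p /\ exists b, b ∈ p /\
  (is_upair a x x /\ is_upair b x y /\ is_upair p a b).

(** Triples are iterated Kuratowski pairs. The inner pair [q] is an element of an element of [p],
    which keeps the formula Δ_0. *)
Definition is_triple p x y z := exists a, a ∈ p /\ exists q, q ∈ a /\
  (is_pair q y z /\ is_pair p x q).

Lemma D0_ins i j k : D0 (fun e : nat -> M => is_ins (e i) (e j) (e k)).
Proof. by rewrite /is_ins; repeat d0_step. Qed.

Lemma D0_sel i j k : D0 (fun e : nat -> M => is_sel (e i) (e j) (e k)).
Proof. by rewrite /is_sel; repeat d0_step. Qed.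

Lemma D0_subs i j : D0 (fun e : nat -> M => subs (e i) (e j)).
Proof. by rewrite /subs; repeat d0_step. Qed.

Lemma D0_rich i j : D0 (fun e : nat -> M => rich (e i) (e j)).
Proof.
rewrite /rich; repeat first [apply: D0_subs|apply: D0_ins|apply: D0_sel|d0_step].
Qed.

Lemma D0_step i j : D0 (fun e : nat -> M => step (e i) (e j)).
Proof.
by rewrite /step; repeat first [apply: D0_ins|apply: D0_sel|d0_step].
Qed.

Lemma D0_triple i j k l :
  D0 (fun e : nat -> M => is_triple (e i) (e j) (e k) (e l)).
Proof. by rewrite /is_triple /is_pair /is_upair; repeat d0_step. Qed.

End Predicates.

Ltac d0 := repeat first
  [ apply: D0_ins | apply: D0_sel | apply: D0_subs | apply: D0_rich
  | apply: D0_step | apply: D0_triple | d0_step ].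

(** * Renaming of variables *)

Definition up (r : nat -> nat) n := if n is m.+1 then (r m).+1 else 0.

Fixpoint ren (r : nat -> nat) (p : formula) : formula :=
  match p with
  | FMem i j => FMem (r i) (r j)
  | FEq i j => FEq (r i) (r j)
  | FBot => FBot
  | FAnd p q => FAnd (ren r p) (ren r q)
  | FOr p q => FOr (ren r p) (ren r q)
  | FImp p q => FImp (ren r p) (ren r q)
  | FAll p => FAll (ren (up r) p)
  | FEx p => FEx (ren (up r) p)
  end.

Lemma sat_ren (M : structure) p r (e : nat -> M) :
  sat (ren r p) e <-> sat p (fun n => e (r n)).
Proof.
elim: p r e => //= [p hp q hq|p hp q hq|p hp q hq|p hp|p hp] r e;
  rewrite ?hp ?hq //.
all: have E x : sat (ren (up r) p) (scons x e) <->
    sat p (scons x (fun n => e (r n))).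
1,3: by rewrite hp (_ : (fun n => _) = scons x (fun n => e (r n))) //;
  apply/funext; case.
- by split=> h x; apply/E/h.
- by split=> -[x /E h]; exists x.
Qed.

Lemma Delta0_ren p r : Delta0 p -> Delta0 (ren r p).
Proof. by move=> d; elim: d r => /= *; constructor; auto. Qed.

Lemma D0_ren (M : structure) (P : (nat -> M) -> Prop) r :
  D0 P -> D0 (fun e => P (fun n => e (r n))).
Proof.
move=> [p dp hp]; exists (ren r p); first exact: Delta0_ren.
by move=> e; rewrite sat_ren.
Qed.

(** * Elementary set theory in KP *)

Section KripkePlatek.
Variables (M : structure) (KP : models_KP M).
Implicit Types (x y z a b s t u p q : M) (e : nat -> M).

Lemma ext x y : (forall z, z ∈ x <-> z ∈ y) -> x = y.
Proof. exact: KP_extensionality. Qed.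

Lemma separation P e a : D0 P ->
  exists b, forall x, x ∈ b <-> x ∈ a /\ P (scons x e).
Proof.
move=> [p dp hp]; have [b hb] := KP_Delta0_separation KP dp e a.
by exists b => x; rewrite hb hp.
Qed.

Lemma collection P e a : D0 P ->
  (forall x, x ∈ a -> exists y, P (scons y (scons x e))) ->
  exists b, forall x, x ∈ a -> exists y, y ∈ b /\ P (scons y (scons x e)).
Proof.
move=> [p dp hp] h.
have [|b hb] := KP_Delta0_collection KP dp (e := e) (a := a).
  by move=> x /h[y /hp hy]; exists y.
by exists b => x /hb[y [yb /hp hy]]; exists y.
Qed.

Lemma foundation P e : Df P -> (exists x, P (scons x e)) ->
  exists x, P (scons x e) /\ forall y, y ∈ x -> ~ P (scons y e).
Proof.
move=> [p hp] [x /hp hx].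
have [|z [hz mz]] := KP_foundation KP (phi := p) (e := e); first by exists x.
by exists z; split=> [|y /mz + /hp]; first exact/hp.
Qed.

Lemma mem_ind P e : Df P ->
  (forall x, (forall y, y ∈ x -> P (scons y e)) -> P (scons x e)) ->
  forall x, P (scons x e).
Proof.
move=> dP h x; apply: contrapT => nx.
have [|z [nz mz]] := foundation (P := fun e => ~ P e) (e := e) (Df_not dP).
  by exists x.
by apply: nz; apply: h => y /mz /contrapT.
Qed.

Lemma ex_bigcup a : exists b, forall x y, x ∈ a -> y ∈ x -> y ∈ b.
Proof. exact: KP_union. Qed.

(** Collection is applied twice: for each [x], to gather witnesses for all [v] in [b] into one set,
    and then to gather these sets, whose union is the bound. *)
Lemma collection2 P e a b : D0 P ->
  (forall x, x ∈ a -> forall v, v ∈ b ->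
    exists y, P (scons y (scons v (scons x e)))) ->
  exists c, forall x, x ∈ a -> forall v, v ∈ b ->
    exists y, y ∈ c /\ P (scons y (scons v (scons x e))).
Proof.
move=> dP h.
pose Q (f : nat -> M) := forall v, v ∈ f 2 -> exists y, y ∈ f 0 /\
  P (scons y (scons v (scons (f 1) (fun n => f n.+3)))).
have dQ : D0 Q.
  apply: D0_all; apply: D0_ex => /=.
  (* Under the two quantifiers the environment begins with [y], [v], the set of witnesses, [x], [b];
     the renaming skips the third and the fifth. *)
  have := D0_ren (fun n => match n with 0 => 0 | 1 => 1 | 2 => 3 | n.+3 => n.+4.+1 end) dP.
  by congr D0; apply/funext => f; congr P; apply/funext => -[|[|[|]]].
have [|c hc] := @collection Q (scons b e) a dQ.
  by move=> x /h /(collection dP) [Y hY]; exists Y.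
have [d hd] := ex_bigcup c.
exists d => x xa v vb; have [Y [Yc /(_ _ vb)[y [yY hy]]]] := hc _ xa.
by exists y; split=> //; apply: hd yY.
Qed.

Lemma ex_sub_upair x y : exists z, forall u, u ∈ z <-> u = x \/ u = y.
Proof.
have [p [xp yp]] := KP_pairing KP x y.
have [|z hz] := @separation (fun e => e 0 = e 1 \/ e 0 = e 2)
  (scons x (scons y (fun=> x))) p; first by d0.
by exists z => u; rewrite hz /=; split=> [[]|] // [] ->; split; auto.
Qed.

Lemma ex_cup x y : exists z, forall u, u ∈ z <-> u ∈ x \/ u ∈ y.
Proof.
have [p hp] := ex_sub_upair x y; have [b hb] := ex_bigcup p.
have [|z hz] := @separation (fun e => e 0 ∈ e 1 \/ e 0 ∈ e 2)
  (scons x (scons y (fun=> x))) b; first by d0.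
exists z => u; rewrite hz /=; split=> [[]|] // h; split=> //.
by case: h; apply: hb; apply/hp; auto.
Qed.

Lemma ex_ins x y : exists z, is_ins z x y.
Proof.
have [s hs] := ex_sub_upair y y; have [z hz] := ex_cup x s.
exists z; split=> [u /hz|]; last by split=> [u ux|]; apply/hz; [left|right; apply/hs; left].
by case=> [|/hs[]]; [left|right|right].
Qed.

Lemma ex_sel s l : exists d, is_sel d s l.
Proof.
have [|d hd] := @separation (fun e => e 1 ∈ e 0) (scons l (fun=> l)) s; first by d0.
by exists d; split=> z; rewrite hd.
Qed.

Lemma ex_empty : exists z, forall u, ~ u ∈ z.
Proof.
have [x] := KP_nonempty KP.
have [|d hd] := @separation (fun=> False) (fun=> x) x; first by d0.
by exists d => u /hd[].
Qed.

Lemma is_ins_inj z z' x y : is_ins z x y -> is_ins z' x y -> z = z'.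
Proof.
move=> [h1 [h2 h3]] [k1 [k2 k3]]; apply: ext => u.
by split=> [/h1|/k1] [|->] //; auto.
Qed.

Lemma is_sel_inj d d' s l : is_sel d s l -> is_sel d' s l -> d = d'.
Proof.
move=> [h1 h2] [k1 k2]; apply: ext => u.
by split=> [/h1|/k1] [] ? ?; auto.
Qed.

(** The sets described by [is_ins] and [is_sel] exist and are unique, so asking for some such
    element of [t] is asking for every one. *)
Lemma richP s t : rich s t <-> forall u, step u s -> u ∈ t.
Proof.
split=> [[h1 [h2 h3]] u|h].
  case=> [/h1//|[[x [xs [y [ys hu]]]]|[l [ls hu]]]].
    by have [z [zt hz]] := h2 _ xs _ ys; rewrite (is_ins_inj hu hz).
  by have [z [zt hz]] := h3 _ ls; rewrite (is_sel_inj hu hz).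
split=> [x xs|]; first by apply: h; left.
split=> [x xs y ys|l ls].
  have [z hz] := ex_ins x y; exists z; split=> //; apply: h; right; left.
  by exists x; split=> //; exists y.
have [d hd] := ex_sel s l; exists d; split=> //; apply: h; right; right.
by exists l.
Qed.

Lemma rich_sub s t x : rich s t -> x ∈ s -> x ∈ t.
Proof. by move=> [h _]; apply: h. Qed.

Lemma rich_ins s t x y : rich s t -> x ∈ s -> y ∈ s ->
  exists z, z ∈ t /\ is_ins z x y.
Proof. by move=> [_ [h _]] xs ys; apply: h. Qed.

Lemma rich_mono s t t' : rich s t -> subs t t' -> rich s t'.
Proof. by move=> /richP h tt'; apply/richP => u /h /tt'. Qed.

Lemma ex_rich s : exists t, rich s t.
Proof.
have [||Y hY] := @collection2 (fun e => is_ins (e 0) (e 2) (e 1)) (fun=> s) s s.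
- by d0.
- by move=> x _ v _; exact: ex_ins.
have [||Z hZ] := @collection (fun e => is_sel (e 0) (e 2) (e 1)) (fun=> s) s.
- by d0.
- by move=> x _; exact: ex_sel.
have [V hV] := ex_cup Y Z; have [W hW] := ex_cup s V.
exists W; split=> [x xs|]; first by apply/hW; left.
split=> [x xs y ys|l ls].
  have [z [zY hz]] := hY _ xs _ ys; exists z; split=> //.
  by apply/hW; right; apply/hV; left.
have [z [zZ hz]] := hZ _ ls; exists z; split=> //.
by apply/hW; right; apply/hV; right.
Qed.

Lemma upair_inj p x y x' y' : is_upair p x y -> is_upair p x' y' ->
  x = x' /\ y = y' \/ x = y' /\ y = x'.
Proof.
move=> [xp [yp hp]] [x'p [y'p hp']].
have := hp' _ xp; have := hp' _ yp; have := hp _ x'p; have := hp _ y'p.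
by do 4! case=> ?; subst; auto.
Qed.

Lemma pair_inj p x y x' y' : is_pair p x y -> is_pair p x' y' ->
  x = x' /\ y = y'.
Proof.
move=> [a [_ [b [_ [ha [hb hp]]]]]] [a' [_ [b' [_ [ha' [hb' hp']]]]]].
case: (upair_inj hp hp') => -[? ?]; subst a' b'.
  case: (upair_inj ha ha') => -[? _]; subst x';
  by case: (upair_inj hb hb') => -[? ?]; subst.
case: (upair_inj ha hb') => -[? ?]; subst;
by case: (upair_inj hb ha') => -[? ?]; subst.
Qed.

Lemma triple_inj p x y z x' y' z' : is_triple p x y z -> is_triple p x' y' z' ->
  [/\ x = x', y = y' & z = z'].
Proof.
move=> [a [_ [q [_ [hq hp]]]]] [a' [_ [q' [_ [hq' hp']]]]].
have [? ?] := pair_inj hp hp'; subst q' x'.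
by have [? ?] := pair_inj hq hq'.
Qed.

Lemma ex_pair x y : exists2 p, is_pair p x y & exists2 a, a ∈ p & y ∈ a.
Proof.
have [a ha] := ex_sub_upair x x; have [b hb] := ex_sub_upair x y.
have [p hp] := ex_sub_upair a b.
have ap : a ∈ p by apply/hp; left.
have bp : b ∈ p by apply/hp; right.
have yb : y ∈ b by apply/hb; right.
exists p; last by exists b.
exists a; split=> //; exists b; split=> //.
split; [|split]; split; try split; try by move=> u /ha.
all: try by apply/ha; left.
all: try by apply/hb; left.
all: try by move=> u /hb.
all: by [|move=> u /hp].
Qed.

Lemma ex_triple x y z : exists p, is_triple p x y z.
Proof.
have [q hq _] := ex_pair y z; have [p hp [a ap qa]] := ex_pair x q.
by exists p, a; split=> //; exists q.
Qed.

Lemma set_foundation c x : x ∈ c -> exists2 y, y ∈ c & forall z, z ∈ y -> z ∉ c.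
Proof.
move=> xc; have [||y [yc hy]] := @foundation (fun e => e 0 ∈ e 1) (scons c (fun=> c)).
- exact/Df_D0/D0_mem.
- by exists x.
- by exists y => // z /hy.
Qed.

(** A cycle is collected into a set [c] by finitely many insertions; every element of [c] would then
    have an element in [c], against foundation. *)
Lemma mem_acyclic x : ~ clos_trans M (@mem_in M) x x.
Proof.
suff H y z : clos_trans_n1 M (@mem_in M) y z -> exists2 c, z ∈ c &
    forall v, v ∈ c -> exists2 w, w ∈ v & w ∈ c \/ w = y.
  move=> xx; have [c xc hc] := H _ _ (clos_trans_tn1 _ _ _ _ xx).
  have [v vc hv] := set_foundation xc.
  by have [w wv [|?]] := hc _ vc; [exact: hv|subst w; exact: hv xc].
elim=> [{}z yz|{}z t zt _ [c zc hc]].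
  have [c hc] := ex_sub_upair z z; exists c; first by apply/hc; left.
  by move=> v /hc[] ->; exists y => //; right.
have [c' [h1 [h2 h3]]] := ex_ins c t; exists c' => // v /h1 [/hc[w wv [wc|wy]]|->].
- by exists w => //; left; exact: h2.
- by exists w => //; right.
- by exists z => //; left; exact: h2.
Qed.

Lemma mem_irr x : x ∉ x.
Proof. by move=> h; apply: (@mem_acyclic x); apply: t_step. Qed.

End KripkePlatek.

(** * Embedding a relation along a tower of rich sets *)

(** Recursion along [R] in which the value at [x] only has to satisfy a relation to the earlier
    values, and is picked by choice. *)
Lemma well_founded_choice (A T : Type) (R : A -> A -> Prop) (x0 : T)
    (P : A -> (A -> T) -> T -> Prop) :
  well_founded R ->
  (forall x f g y, (forall z, R z x -> f z = g z) -> P x f y -> P x g y) ->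
  (forall x f, (forall z, R z x -> P z f (f z)) -> exists y, P x f y) ->
  exists J : A -> T, forall x, P x J (J x).
Proof.
move=> wfR Pext Pex; set Rt := clos_trans A R.
have /choice[g hg] (xf : A * (A -> T)) : exists y,
    (forall z, R z xf.1 -> P z xf.2 (xf.2 z)) -> P xf.1 xf.2 y.
  case: xf => x f /=.
  have [/Pex[y hy]|nh] := pselect (forall z, R z x -> P z f (f z)).
    by exists y.
  by exists x0.
(* The recursion follows the transitive closure, because correctness at a predecessor [z] of [x]
   also involves the predecessors of [z]. *)
pose F x (rec : forall y, Rt y x -> T) := g (x, fun y =>
  if pselect (Rt y x) is left h then rec y h else x0).
pose J := Fix (wf_clos_trans _ _ wfR) (fun=> T) F.
exists J; elim/(well_founded_ind wfR) => x IH.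
have -> : J x = g (x, fun y => if pselect (Rt y x) then J y else x0).
  rewrite /J Fix_eq => [|u r r' rr'];
    first by congr (g (_, _)); apply/funext => y; case: pselect.
  by congr (g (_, _)); apply/funext => y; case: pselect.
set f := fun y => _.
have fJ z : Rt z x -> f z = J z by rewrite /f; case: pselect.
apply: (Pext x f) => [z zx|]; first by rewrite fJ //; apply: t_step.
apply: (hg (x, f)) => z /= zx; rewrite fJ; last exact: t_step.
apply: Pext (IH _ zx) => u uz; rewrite fJ //.
by apply: t_trans (t_step _ _ _ _ zx); apply: t_step.
Qed.

Lemma well_founded_ltn : well_founded (fun m n : nat => m < n).
Proof. by move=> n; elim/ltn_ind: n => n IH; constructor. Qed.

Section Core.
Variables (M : structure) (KP : models_KP M).

(** Elements are inserted one at a time, each insertion costing one step of the chain; the [g i]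
    stay available since the chain increases. *)
Lemma adjoin_finite (t : nat -> M) : (forall n, rich (t n) (t n.+1)) ->
  forall (g : nat -> M) (s : seq nat), (forall i, i \in s -> g i ∈ t 0) ->
  forall k d, d ∈ t k -> exists n, exists2 y, y ∈ t n &
    forall z, z ∈ y <-> z ∈ d \/ exists2 i, i \in s & z = g i.
Proof.
move=> ht g s hs k d dk.
have t0 n x : x ∈ t 0 -> x ∈ t n.
  by elim: n => // n IH /IH; apply: rich_sub.
elim: s hs => [|i s IH] hs.
  by exists k, d => // z; split=> [|[|[]]] //; left.
have [j js|n [y yn hy]] := IH; first by apply: hs; rewrite inE js orbT.
have /(t0 n) gi := hs i (mem_head _ _).
have [y' [y'n [h1 [h2 h3]]]] := rich_ins (ht n) yn gi.
exists n.+1, y' => // z; split=> [/h1[/hy[|[j js ->]]|->]|[zd|[j]]].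
- by left.
- by right; exists j => //; rewrite inE js orbT.
- by right; exists i => //; rewrite mem_head.
- by apply/h2/hy; left.
- by rewrite inE => /predU1P[-> ->//|js ->]; apply/h2/hy; right; exists j.
Qed.

(* The image of [a], with index [k], consists of the images of the earlier
   elements of [a], of the labels of the earlier elements containing [a], of
   its own label [l k], and of everything in [t a 0] that carries [l k]: the
   later elements of [a] are caught by the last clause. *)
Lemma embeddable_of_rich (A : structure) (c : A -> nat) (t : A -> nat -> M)
    (l : nat -> M) :
  injective c -> injective l -> (forall i k, l i ∉ l k) ->
  (forall a i, l i ∈ t a 0) ->
  (forall a n, rich (t a n) (t a n.+1)) ->
  (forall a b, a ∈ b -> forall n, rich (t a n) (t b 0)) ->
  embeddable A M.
Proof.
move=> cI lI ll lt tt tE.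
pose P n (f : nat -> M) y := forall a, c a = n -> (exists m, y ∈ t a m) /\
  forall z, z ∈ y <-> [\/ z ∈ t a 0 /\ l n ∈ z, z = l n,
    exists b, [/\ c b < n, b ∈ a & z = f (c b)] |
    exists b, [/\ c b < n, a ∈ b & z = l (c b)]].
have [J hJ] : exists J : nat -> M, forall n, P n J (J n).
  apply: (@well_founded_choice _ _ _ (l 0) P well_founded_ltn) =>
      [n f g y fg hy a /hy[hm hz]|n f hf].
    split=> // z; rewrite hz; split=> -[?|?|[b [bn ba ->]]|?];
      try by [apply: Or41|apply: Or42|apply: Or44].
      by apply: Or43; exists b; rewrite fg.
    by apply: Or43; exists b; rewrite fg.
  have [[a can]|na] := pselect (exists a, c a = n); last first.
    by exists (l 0) => a can; case: na; exists a.
  have [d [dt hd]] : exists d, d ∈ t a 1 /\ is_sel d (t a 0) (l n).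
    by have [_ [_ h]] := tt a 0; apply: h.
  pose s1 := [seq i <- iota 0 n | `[< exists2 b, c b = i & b ∈ a >]].
  pose s2 := [seq i <- iota 0 n | `[< exists2 b, c b = i & a ∈ b >]].
  have [i|k1 [d1 d1k h1]] := adjoin_finite (tt a) (g := f) (s := s1) _ dt.
    rewrite mem_filter mem_iota => /andP[/asboolP[b <- ba] cbn].
    have [[m hm] _] := hf _ cbn _ erefl.
    exact: rich_sub (tE _ _ ba m) hm.
  have [i _|k2 [d2 d2k h2]] := adjoin_finite (tt a) (g := l) (s := n :: s2) _ d1k.
    exact: lt.
  exists d2 => a'; rewrite -can => /cI ->; split; first by exists k2.
  move=> z; rewrite h2 h1 can; split.
    case=> [[/hd.1[]|]|].
    - by move=> *; apply: Or41.
    - move=> [i]; rewrite mem_filter mem_iota => /andP[/asboolP[b <- ba] cbn] ->.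
      by apply: Or43; exists b.
    - move=> [i]; rewrite inE => /predU1P[-> ->|]; first exact: Or42.
      rewrite mem_filter mem_iota => /andP[/asboolP[b <- ba] cbn] ->.
      by apply: Or44; exists b.
  case=> [[? ?]|->|[b [cbn ba ->]]|[b [cbn ba ->]]].
  - by left; left; apply: hd.2.
  - by right; exists n; rewrite ?mem_head.
  - left; right; exists (c b) => //; rewrite mem_filter mem_iota leq0n cbn !andbT.
    by apply/asboolP; exists b.
  - right; exists (c b) => //; rewrite inE mem_filter mem_iota leq0n cbn !andbT.
    by apply/orP; right; apply/asboolP; exists b.
pose j a := J (c a).
have jt a : exists m, j a ∈ t a m by have [] := hJ _ a erefl.
have jE a z : z ∈ j a <-> [\/ z ∈ t a 0 /\ l (c a) ∈ z, z = l (c a),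
    exists b, [/\ c b < c a, b ∈ a & z = j b] |
    exists b, [/\ c b < c a, a ∈ b & z = l (c b)]].
  by have [_] := hJ _ a erefl; apply.
have lj a : l (c a) ∈ j a by apply/jE/Or42.
(* The other clauses bring no label into [j a]: no label contains a label, whereas every image
   contains its own. *)
have ljE i a : l i ∈ j a -> i = c a \/ exists b, [/\ c b < c a, a ∈ b & i = c b].
  move/jE => [[_ /ll//]|/lI|[b [_ _ lb]]|[b [? ? /lI]]]; first by left.
    by case: (ll (c b) i); rewrite lb.
  by right; exists b.
(* The index of [a] is the largest [i] with [l i] in [j a]. *)
have jI : injective j.
  move=> a b ab; apply: cI; have := lj a; have := lj b.
  rewrite -{1}ab => /ljE[//|[b' [h1 _ e1]]]; rewrite ab => /ljE[//|[a' [h2 _ e2]]].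
  by move: h1 h2; rewrite -e1 -e2 => /ltn_trans h /h; rewrite ltnn.
exists j; split=> // a b; split=> [ab|jab].
  (* If [a] comes before [b], its image was put into [j b] explicitly; otherwise [j a] carries the
     label of [b] and lies in [t b 0]. *)
  have [lab|lba] := ltnP (c a) (c b); apply/jE; first by apply: Or43; exists a.
  apply: Or41; split.
    by have [m] := jt a; apply: rich_sub; apply: tE.
  have [/cI <- //|cba] := eqVneq (c b) (c a).
  by apply/jE/Or44; exists b; split=> //; rewrite ltn_neqAle cba.
(* An image is never a label. If [j a] carries the label of [b], then [a ∈ b], or [a] equals [b],
   which foundation excludes. *)
have /jE := jab.
case=> [[_ /ljE[/cI ba|[b' [_ ab' /cI -> //]]]]|ja|[b' [_ b'b /jI -> //]]|[b' [_ _ ja]]].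
- by move: jab; rewrite ba => /(mem_irr KP).
- by case: (ll (c a) (c b)); rewrite -ja.
- by case: (ll (c a) (c b')); rewrite -ja.
Qed.

End Core.

(** * Gaps *)

(* [gap s t g] means that [rich s t] and that for every [d ∈ g] there are [u] and
   [t'] included in [t] with [gap s u d] and [gap u t' d].  This recursion is made
   Σ_1 by a certificate: a set [r] of triples with components in [b]; all its
   clauses are positive in [r] and [b], so unions of certificates are certificates. *)
Section Gap.
Variables (M : structure).

Definition gap_node (r b p : M) := exists s, s ∈ b /\ exists t, t ∈ b /\
  exists g, g ∈ b /\ (is_triple p s t g /\ rich s t /\
  forall d, d ∈ g -> exists u, u ∈ b /\ exists t', t' ∈ b /\
    exists p1, p1 ∈ r /\ exists p2, p2 ∈ r /\
    (is_triple p1 s u d /\ is_triple p2 u t' d /\ subs t' t)).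

Definition gap_cert (r b : M) := forall p, p ∈ r -> gap_node r b p.

Definition gap (s t g : M) :=
  exists r b p, gap_cert r b /\ p ∈ r /\ is_triple p s t g.

Lemma D0_gap_cert i j : D0 (fun e : nat -> M => gap_cert (e i) (e j)).
Proof. by rewrite /gap_cert /gap_node; d0. Qed.

Lemma gap_node_mono r b r' b' p : subs r r' -> subs b b' ->
  gap_node r b p -> gap_node r' b' p.
Proof.
move=> rr bb [s [/bb sb [t [/bb tb [g [/bb gb [hp [st h]]]]]]]].
exists s; split=> //; exists t; split=> //; exists g; split=> //.
split=> //; split=> // d /h [u [/bb ub [t' [/bb t'b [p1 [/rr p1r [p2 [/rr p2r h']]]]]]]].
exists u; split=> //; exists t'; split=> //; exists p1; split=> //.
by exists p2; split.
Qed.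

Hypothesis KP : models_KP M.

Lemma gap_rich s t g : gap s t g -> rich s t.
Proof.
move=> [r [b [p [hr [pr hp]]]]].
have [s' [_ [t' [_ [g' [_ [hp' [st _]]]]]]]] := hr _ pr.
by have [-> -> _] := triple_inj hp hp'.
Qed.

Lemma gap_split s t g d : gap s t g -> d ∈ g ->
  exists u t', [/\ gap s u d, gap u t' d & subs t' t].
Proof.
move=> [r [b [p [hr [pr hp]]]]].
have [s' [_ [t' [_ [g' [_ [hp' [_ h]]]]]]]] := hr _ pr.
have [? ? ?] := triple_inj hp hp'; subst s' t' g'.
move=> /h [u [_ [t' [_ [p1 [p1r [p2 [p2r [h1 [h2 h3]]]]]]]]]].
by exists u, t'; split=> //; exists r, b; [exists p1|exists p2].
Qed.

Lemma ex4 (x y z t : M) : exists a, [/\ x ∈ a, y ∈ a, z ∈ a & t ∈ a].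
Proof.
have [a [_ [_ ta]]] := ex_ins KP t t.
have [b [_ [ab zb]]] := ex_ins KP a z.
have [c [_ [bc yc]]] := ex_ins KP b y.
have [d [_ [cd xd]]] := ex_ins KP c x.
by exists d; split; auto.
Qed.

(** By ∈-induction inside [M], valid even if [M] is ill-founded. For each [d] in [g] two consecutive
    [d]-gaps from [s] are collected; [t] is a set rich over [s], enlarged to include their far
    ends. *)
Lemma ex_gap g s : exists t, gap s t g.
Proof.
pose P (e : nat -> M) := forall s, exists t, gap s t (e 0).
have [x0] := KP_nonempty KP.
suff H x : P (scons x (fun=> x0)) by apply: (H g).
apply: (mem_ind KP) x => {g s} [|g IH s].
  by rewrite /P /gap; do !(apply: Df_all || apply: Df_ex); apply: Df_D0;
     do !(apply: D0_gap_cert || d0_step || apply: D0_triple).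
rewrite /P /= in IH *.
pose Q (e : nat -> M) := exists t1, t1 ∈ e 0 /\ exists t2, t2 ∈ e 0 /\
  exists r, r ∈ e 0 /\ exists b, b ∈ e 0 /\ exists p1, p1 ∈ r /\
  exists p2, p2 ∈ r /\ (gap_cert r b /\ is_triple p1 (e 2) t1 (e 1) /\
    is_triple p2 t1 t2 (e 1)).
have [||Y hY] := collection KP (P := Q) (e := scons s (fun=> s)) (a := g).
- by rewrite /Q; do !(apply: D0_gap_cert || d0_step || apply: D0_triple).
- move=> d /IH {}IH; have [t1 [r1 [b1 [p1 [hr1 [p1r hp1]]]]]] := IH s.
  have [t2 [r2 [b2 [p2 [hr2 [p2r hp2]]]]]] := IH t1.
  have [r hr] := ex_cup KP r1 r2; have [b hb] := ex_cup KP b1 b2.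
  have [y [h1 h2 h3 h4]] := ex4 t1 t2 r b.
  exists y, t1; split=> //; exists t2; split=> //; exists r; split=> //.
  exists b; split=> //; exists p1; split; first by apply/hr; left.
  exists p2; split; first by apply/hr; right.
  split=> // p /hr[/hr1|/hr2]; apply: gap_node_mono => x xx; apply/hr || apply/hb; auto.
have [U hU] := ex_bigcup KP Y; have [V hV] := ex_bigcup KP U.
(* Collection may also return unwanted sets, so only elements of genuine certificates are kept. *)
have [|R hR] := separation KP
    (P := fun e => exists r, r ∈ e 1 /\ (e 0 ∈ r /\ exists b, b ∈ e 1 /\ gap_cert r b))
    (scons U (fun=> U)) V.
  by do !(apply: D0_gap_cert || d0_step).
have [T0 sT0] := ex_rich KP s; have [T hT] := ex_cup KP T0 V.
have sT : rich s T by apply: rich_mono sT0 _ => // x; move=> xx; apply/hT; left.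
have [p hp] := ex_triple KP s T g.
have [R' [R1 [R2 pR']]] := ex_ins KP R p.
have [B0 [sB0 TB0 gB0 _]] := ex4 s T g g; have [B hB] := ex_cup KP B0 V.
have VB : subs V B by move=> x xV; apply/hB; right.
exists T, R', B, p; split=> // q /R1 [/hR [qV [r [rU [qr [b [bU hb]]]]]]|->].
  apply: gap_node_mono (hb _ qr); last by move=> x /(hV _ _ bU) /VB.
  move=> x xr; apply/R2/hR; split; first exact: hV rU xr.
  by exists r; split=> //; split=> //; exists b.
exists s; split; first by apply/hB; left.
exists T; split; first by apply/hB; left.
exists g; split; first by apply/hB; left.
split=> //; split=> // d /hY [y [yY [t1 [t1y [t2 [t2y [r [ry [b [yb]]]]]]]]]].
move=> [p1 [p1r [p2 [p2r [hb [hp1 hp2]]]]]].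
have inU := hU _ _ yY.
have inR v : v ∈ r -> v ∈ R'.
  move=> vr; apply/R2/hR; split; first exact: hV (inU _ ry) vr.
  by exists r; split; [exact: inU|split=> //]; exists b; split=> //; exact: inU.
have inB v : v ∈ b -> v ∈ B by move=> vb; apply/VB/(hV b) => //; apply: inU.
have [s' [_ [t' [t'b [g' [_ [hq _]]]]]]] := hb _ p1r.
have [_ ? _] := triple_inj hp1 hq; subst t'.
have [s'' [_ [t'' [t''b [g'' [_ [hq' _]]]]]]] := hb _ p2r.
have [_ ? _] := triple_inj hp2 hq'; subst t''.
exists t1; split; first exact: inB t'b.
exists t2; split; first exact: inB t''b.
exists p1; split; first exact: inR.
exists p2; split; first exact: inR.
split=> //; split=> // x xt2; apply/hT; right; exact: hV (inU _ t2y) xt2.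
Qed.

Lemma rich_trans (s t u : M) : rich s t -> rich t u -> rich s u.
Proof. by move=> st [h _]; apply: rich_mono st h. Qed.

Fixpoint depth_ge n (x : M) :=
  if n is m.+1 then exists2 y, y ∈ x & depth_ge m y else True.

(** Depth is measured by standard natural numbers; in a well-founded model this says that the rank
    is at least ω. *)
Definition infinite_depth x := forall n, depth_ge n x.

(** The gap is split along a descending chain below [g]: each left half gives one step, and the
    right half is split further. *)
Lemma gap_chain n g s t : gap s t g -> depth_ge n g ->
  exists f : nat -> M, [/\ f 0 = s, forall i, i < n -> rich (f i) (f i.+1) &
    subs (f n) t].
Proof.
elim: n g s t => [g s t st _|n IH g s t st [d dg hd]].
  by exists (fun=> s); split=> // x; have := gap_rich st; apply: rich_sub.
have [u [t' [su ut' t't]]] := gap_split st dg.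
have [f [f0 hf ft']] := IH _ _ _ ut' hd.
exists (fun i => if i is k.+1 then f k else s); split=> // [[|i] /=|x /ft' /t't //].
  by rewrite f0 => _; apply: gap_rich su.
exact: hf.
Qed.

(* [n0 i] is an [i]-fold nested singleton and [l i] is [{∅, n0 i.+1}]: having two
   elements, a label is never an element of a label. *)
Lemma ex_labels g : infinite_depth g -> exists om : M, exists n0 l : nat -> M,
  [/\ forall i, n0 i ∈ om, forall i, n0 i ∈ n0 i.+1,
      forall i, l i ∈ om, injective l & forall i k, l i ∉ l k].
Proof.
move=> hg; have [z hz] := ex_empty KP; have [s [_ [_ zs]]] := ex_ins KP z z.
(* For each standard [n], a chain of [n] rich steps from [{∅}] ends inside [om], which therefore
   contains all [n0 i] and [l i]. *)
have [om som] := ex_gap g s.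
have [sing hsing] : exists sing : M -> M, forall x, is_ins (sing x) z x.
  by have /choice[f hf] := ex_ins KP z; exists f.
have [lab hlab] : exists lab : M -> M, forall x, is_ins (lab x) (sing z) x.
  by have /choice[f hf] := ex_ins KP (sing z); exists f.
pose n0 i := iter i sing z.
have zlab x : z ∈ lab x.
  by have [_ [h _]] := hlab x; apply: h; have [_ []] := hsing z.
have labE u x : u ∈ lab x -> u = z \/ u = x.
  have [h _] := hlab x; have [h' _] := hsing z.
  by case/h=> [/h'[/hz|->]|]; [|left|right].
have singE u x : u ∈ sing x -> u = x by have [h _] := hsing x; case/h => [/hz|].
have xsing x : x ∈ sing x by have [_ []] := hsing x.
have n0om i k f : (forall j, j < i + k -> rich (f j) (f j.+1)) -> f 0 = s ->
    n0 i ∈ f (i + k).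
  have mono j m : (forall i, i < j + m -> rich (f i) (f i.+1)) -> subs (f j) (f (j + m)).
    elim: m => [_|m IH h]; first by rewrite addn0.
    move=> x /IH hx; rewrite addnS; apply: rich_sub (h (j + m) _) _.
      by rewrite addnS.
    by apply: hx => q qm; apply: h; rewrite addnS ltnW.
  elim: i k => [|i IH] k hf f0.
    by apply: (mono 0 k) => //; rewrite f0.
  have fz : z ∈ f (i + k).
    apply: (mono 0 (i + k)); last by rewrite f0.
    by move=> q /ltnW ?; apply: hf.
  have fi : n0 i ∈ f (i + k) by apply: IH => // q /ltnW ?; apply: hf.
  have [y [yf hy]] := rich_ins (hf (i + k) (leqnn _)) fz fi.
  by rewrite addSn /n0 iterS -/(n0 i) (is_ins_inj KP (hsing _) hy).
exists om, n0, (fun i => lab (n0 i.+1)); split=> //.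
- move=> i; have [f [f0 hf ft]] := gap_chain som (hg i); apply: ft.
  by rewrite -[X in f X]addn0; apply: n0om => //; rewrite addn0.
(* The label is formed one step after [n0 i.+1] has appeared. *)
- move=> i; have [f [f0 hf ft]] := gap_chain som (hg (i.+1 + 1)); apply: ft.
  have hf' j : j < i.+1 + 0 -> rich (f j) (f j.+1).
    by rewrite addn0 => ji; apply: hf; rewrite addn1 ltnS ltnW.
  have h1 : sing z ∈ f (i.+1 + 0).
    rewrite addn0 -add1n; apply: (n0om 1) => // j.
    by rewrite add1n -[i.+1]addn0; apply: hf'.
  have hfi : rich (f (i.+1 + 0)) (f (i.+1 + 0).+1) by apply: hf; rewrite addn0 addn1.
  have [y [yf hy]] := rich_ins hfi h1 (n0om i.+1 0 f hf' f0).
  by rewrite (is_ins_inj KP (hlab _) hy) addn1 -[X in f X.+1]addn0.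
- move=> i k eq_lab.
  have n0S j : n0 j.+1 <> z by move=> e; apply: (hz (n0 j)); rewrite -e; apply: (xsing (n0 j)).
  have n0I : injective n0.
    elim=> [|j IH] [|m] // e; [by case: (n0S m)|by case: (n0S j)|].
    by congr S; apply: IH; apply: singE; rewrite -[sing _]e; apply: xsing.
  have : n0 i.+1 ∈ lab (n0 k.+1).
    by rewrite -eq_lab; have [_ []] := hlab (n0 i.+1).
  by case/labE => [/n0S //|/n0I []].
- move=> i k /labE[e|e]; first by apply: (hz z); rewrite -{2}e; apply: zlab.
  have /singE zk : z ∈ n0 k.+1 by rewrite -e; apply: zlab.
  have /singE ik : n0 i.+1 ∈ n0 k.+1 by rewrite -e; have [_ []] := hlab (n0 i.+1).
  by apply: (hz (n0 i)); rewrite zk -ik; apply: (xsing (n0 i)).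
Qed.

End Gap.

(** * Ill-founded models are universal *)

Lemma countable_inj (T : Type) : countable [set: T] -> exists c : T -> nat, injective c.
Proof.
by move=> /countable_injP[c hc]; exists c => x y; apply: hc; rewrite inE.
Qed.

(** * Countable orders mapped into dense orders *)

Section DenseOrder.
Variables (T : Type) (R : T -> T -> Prop) (bot top : T).
Hypothesis Rtr : forall x y z, R x y -> R y z -> R x z.
Hypothesis Rirr : forall x, ~ R x x.
Hypothesis Rdense : forall x y, R x y -> exists z, R x z /\ R z y.
Hypothesis Rbt : R bot top.

(** Stated for a general [Q], so that the converse of [R] yields minima. *)
Lemma finite_max (Q : T -> T -> Prop) (b : T) (f : nat -> T) (s : seq nat) :
  (forall x y z, Q x y -> Q y z -> Q x z) ->
  (forall i, i \in s -> Q b (f i)) ->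
  (forall i k, i \in s -> k \in s -> [\/ i = k, Q (f i) (f k) | Q (f k) (f i)]) ->
  exists2 a, a = b \/ (exists2 i, i \in s & a = f i) &
    forall i, i \in s -> Q (f i) a \/ f i = a.
Proof.
move=> Qtr; elim: s => [|i s IH] hb hs; first by exists b => //; left.
have sub k : k \in s -> k \in i :: s by rewrite inE orbC => ->.
have [k ks|k m ks ms|a ha hm] := IH; [exact/hb/sub|by apply: hs; apply: sub|].
have is' := mem_head i s.
have [qa|qa] : Q (f i) a \/ f i = a \/ Q a (f i).
- case: ha => [->|[k ks ->]]; first by right; right; apply: hb.
  by case: (hs i k is' (sub _ ks)) => [->||]; [right; left|left|right; right].
- exists a; first by case: ha => [->|[k ks ->]]; [left|right; exists k => //; apply: sub].
  by move=> k; rewrite inE => /predU1P[->|/hm //]; left.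
- exists (f i) => [|k]; first by right; exists i.
  rewrite inE => /predU1P[->|/hm]; first by right.
  by case: qa => [<-|qa]; [|case=> [/Qtr/(_ qa)|->]; left].
Qed.

(** Density is applied between the largest lower value and the least upper value, with [bot] and
    [top] standing in when a list is empty. *)
Lemma dense_cut (f : nat -> T) (s1 s2 : seq nat) :
  (forall i, i \in s1 ++ s2 -> R bot (f i) /\ R (f i) top) ->
  (forall i k, i \in s1 ++ s2 -> k \in s1 ++ s2 ->
    [\/ i = k, R (f i) (f k) | R (f k) (f i)]) ->
  (forall i k, i \in s1 -> k \in s2 -> R (f i) (f k)) ->
  exists y, [/\ R bot y, R y top, forall i, i \in s1 -> R (f i) y &
    forall i, i \in s2 -> R y (f i)].
Proof.
move=> hbt htot h12.
have in1 i : i \in s1 -> i \in s1 ++ s2 by rewrite mem_cat => ->.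
have in2 i : i \in s2 -> i \in s1 ++ s2 by rewrite mem_cat orbC => ->.
have [||a ha hal] := @finite_max R bot f s1 Rtr.
- by move=> i /in1 /hbt[].
- by move=> i k /in1 i1 /in1 k1; apply: htot.
have [|||b hb hbl] := @finite_max (fun x y => R y x) top f s2.
- by move=> x y z xy yz; apply: Rtr yz xy.
- by move=> i /in2 /hbt[].
- by move=> i k /in2 i2 /in2 k2; case: (htot i k i2 k2) => ?;
    [apply: Or31|apply: Or33|apply: Or32].
have ab : R a b.
  case: ha => [->|[i i1 ->]]; case: hb => [->//|[k k2 ->]].
  - by have [] := hbt _ (in2 _ k2).
  - by have [] := hbt _ (in1 _ i1).
  - exact: h12.
have [y [ay yb]] := Rdense ab; exists y; split.
- by case: ha => [<-//|[i /in1/hbt[h _] ai]]; apply: Rtr h _; rewrite -ai.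
- by case: hb => [<-//|[i /in2/hbt[_ h] ai]]; apply: Rtr _ h; rewrite -ai.
- by move=> i /hal[/Rtr/(_ ay)//|->].
- by move=> i /hbl[/(Rtr yb)//|->].
Qed.

(** Values are chosen one by one. The invariant [P] keeps them pairwise comparable, so that each new
    value is placed in a cut of the earlier ones. *)
Lemma nat_order_to_dense (lt : nat -> nat -> Prop) :
  (forall i j k, lt i j -> lt j k -> lt i k) -> (forall i, ~ lt i i) ->
  exists f : nat -> T, (forall i, R bot (f i)) /\
    forall i j, lt i j -> R (f i) (f j).
Proof.
move=> ltr lirr.
pose P n (f : nat -> T) y := [/\ R bot y, R y top &
  forall i, i < n -> R (f i) y /\ ~ lt n i \/ R y (f i) /\ ~ lt i n].
have [f hf] : exists f : nat -> T, forall n, P n f (f n).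
  apply: (@well_founded_choice _ _ _ bot P well_founded_ltn) =>
      [n f g y fg [h1 h2 h3]|n f hf].
    by split=> // i ni; rewrite -fg //; apply: h3.
  have cmp i k : i < n -> k < n -> i <> k ->
      R (f i) (f k) /\ ~ lt k i \/ R (f k) (f i) /\ ~ lt i k.
    move=> iN kN ik; case: (ltngtP i k) => [lik|lik|//].
      by have [_ _] := hf _ kN; apply.
    by have [_ _ /(_ _ lik)] := hf _ iN; case; [right|left].
  (* The lower part of the cut is generated by the values of the predecessors of [n]; transitivity
     keeps the successors of [n] out of it. *)
  pose L i := exists2 j, j < n /\ lt j n & i = j \/ R (f i) (f j).
  pose s1 := [seq i <- iota 0 n | `[< L i >]].
  pose s2 := [seq i <- iota 0 n | ~~ `[< L i >]].
  have s1P i : i \in s1 -> L i /\ i < n.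
    by rewrite mem_filter mem_iota => /andP[/asboolP].
  have s2P i : i \in s2 -> ~ L i /\ i < n.
    by rewrite mem_filter mem_iota => /andP[/asboolP].
  have s12P i : i \in s1 ++ s2 -> i < n by rewrite mem_cat => /orP[/s1P[]|/s2P[]].
  have [|||y [by' yt y1 y2]] := @dense_cut f s1 s2.
  - by move=> i /s12P iN; have [] := hf _ iN.
  - move=> i k /s12P iN /s12P kN; have [->|/eqP ik] := eqVneq i k; first exact: Or31.
    by case: (cmp _ _ iN kN ik) => -[? _]; [apply: Or32|apply: Or33].
  - move=> i k /s1P[[j [jN ljn] ij] iN] /s2P[nk kN].
    have kj : j <> k by move=> e; apply: nk; exists j => //; left.
    have jk : R (f j) (f k).
      case: (cmp _ _ jN kN kj) => -[// kj' _].
      by case: nk; exists j => //; right.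
    by case: ij => [->//|ij]; apply: Rtr ij jk.
  exists y; split=> // i iN; have [Li|nLi] := pselect (L i).
    left; split.
      by apply: y1; rewrite mem_filter mem_iota iN; apply/andP; split=> //; apply/asboolP.
    case: Li => j [jN ljn] ij nli; have ji := ltr _ _ _ ljn nli.
    case: ij => [e|ij]; first by apply: (lirr j); rewrite -{2}e.
    have ineqj : i <> j by move=> e; apply: (lirr j); rewrite -{2}e.
    case: (cmp _ _ iN jN ineqj) => -[h //] _; exact: Rirr (Rtr ij h).
  right; split.
    by apply: y2; rewrite mem_filter mem_iota iN; apply/andP; split=> //; apply/asboolP.
  by move=> li; apply: nLi; exists i => //; left.
exists f; split=> [i|i j lij]; first by have [] := hf i.
case: (ltngtP i j) => [ij|ij|ij]; last by case: (lirr i); rewrite {2}ij.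
- by have [_ _ /(_ _ ij)] := hf j; case=> -[].
- by have [_ _ /(_ _ ij)] := hf i; case=> -[].
Qed.

Lemma countable_order_to_dense (X : Type) (c : X -> nat) (lt : X -> X -> Prop) :
  injective c ->
  (forall x y z, lt x y -> lt y z -> lt x z) -> (forall x, ~ lt x x) ->
  exists f : X -> T, (forall x, R bot (f x)) /\
    forall x y, lt x y -> R (f x) (f y).
Proof.
move=> cI ltr lirr.
have [||f [f1 f2]] := @nat_order_to_dense
    (fun i j => exists x y, [/\ c x = i, c y = j & lt x y]).
- move=> i j k [x [y [<- <- xy]]] [y' [z [/cI e <- yz]]].
  by subst y'; exists x, z; split=> //; apply: ltr xy yz.
- by move=> i [x [y [<- /cI e xy]]]; subst y; apply: lirr xy.
exists (fun x => f (c x)); split=> // x y xy.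
by apply: f2; exists x, y.
Qed.

End DenseOrder.

Section IllFounded.
Variables (M : structure) (KP : models_KP M).

(** Russell's argument: with [d] the set of elements of [s] containing [x], the set [d ∪ {x}] would
    lie in [s] and contain [x], hence lie in [d] and in itself. *)
Lemma rich_irr (s x : M) : x ∈ s -> ~ rich s s.
Proof.
move=> xs ss; have [_ [_ /(_ _ xs)[d [ds [d1 d2]]]]] := ss.
have [z [zs [_ [dz xz]]]] := rich_ins ss ds xs.
by apply: (@mem_irr M KP z); apply/dz/d2.
Qed.

Lemma ill_founded_universal (g : nat -> M) : (forall n, g n.+1 ∈ g n) ->
  forall A : structure, countable [set: A] ->
  (forall a : A, ~ clos_trans A (@mem_in A) a a) -> embeddable A M.
Proof.
move=> hg A /countable_inj[c cI] acyc.
have g_inf : infinite_depth (g 0).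
  by move=> n; elim: n (0) => // n IH k /=; exists (g k.+1).
have [om [n0 [l [n0om _ lom lI ll]]]] := ex_labels KP g_inf.
have [top omtop] := ex_gap KP (g 0) om.
(* Including [om] makes the labels available and the sets nonempty, as irreflexivity requires. *)
pose R s t := subs om s /\ exists n t', gap s t' (g n) /\ subs t' t.
have Rrich s t : R s t -> rich s t.
  by move=> [_ [n [t' [/(gap_rich) h tt]]]]; apply: rich_mono h tt.
have [c2 c2I] : exists c2 : A * nat -> nat, injective c2.
  exists (fun p => pickle (c p.1, p.2)) => -[a n] [b m] /= /(pcan_inj pickleK).
  by case=> /cI -> ->.
(* Each element is replaced by ω copies, which become its chain; all copies of [a] precede those of
   [b] when [a ∈ b]. *)
pose lt (p q : A * nat) :=
  clos_trans A (@mem_in A) p.1 q.1 \/ p.1 = q.1 /\ p.2 < q.2.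
have [||||||f [f1 f2]] := @countable_order_to_dense M R om top _ _ _ _ (A * nat) c2 lt c2I.
- move=> s t u [os [n [t' [st t't]]]] tu; split=> //; exists n, t'; split=> //.
  by move=> x /t't; apply: rich_sub (Rrich _ _ tu).
- by move=> s /[dup] [[os _]] /Rrich; apply: (@rich_irr _ (n0 0)); apply: os.
- move=> s t [os [n [t' [st t't]]]].
  have [u [t'' [su ut tt]]] := gap_split st (hg n).
  exists u; split; split=> //.
  + by exists n.+1, u; split=> // x.
  + by move=> x /os; apply: rich_sub; apply: gap_rich su.
  + by exists n.+1, t''; split=> // x /tt/t't.
- by split=> [x|] //; exists 0, top; split=> // x.
- move=> [a n] [b m] [d k] [/= ab|[/= ? nm]] [/= bd|[/= ? mk]]; subst; rewrite /lt /=.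
  + by left; apply: t_trans ab bd.
  + by left.
  + by left.
  + by right; split=> //; apply: ltn_trans nm mk.
- by move=> [a n] [/acyc//|[_]]; rewrite ltnn.
apply: (@embeddable_of_rich M KP A c (fun a n => f (a, n)) l) => //.
- by move=> a i; have /Rrich h := f1 (a, 0); apply: rich_sub h (lom i).
- by move=> a n; apply/Rrich/f2; right.
- by move=> a b ab n; apply/Rrich/f2; left; apply: t_step.
Qed.

End IllFounded.

(** * Well-founded models are compared by their height *)

Definition wf (M : structure) := well_founded (@mem_in M).

Section Rank.

(* Foundation ranks of elements of two structures are compared by simulation,
   without mentioning ordinals. *)
Definition rank_le (A B : structure) (x : A) (y : B) :=
  exists2 S : A -> B -> Prop, S x y &
    forall x y, S x y -> forall x', x' ∈ x -> exists2 y', y' ∈ y & S x' y'.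

Variables A B C : structure.

Lemma rank_leP (x : A) (y : B) :
  rank_le x y <-> forall x', x' ∈ x -> exists2 y', y' ∈ y & rank_le x' y'.
Proof.
split=> [[S Sxy hS] x' x'x|h].
  by have [y' y'y Sxy'] := hS _ _ Sxy _ x'x; exists y' => //; exists S.
exists (fun a b => (a = x /\ b = y) \/ rank_le a b); first by left.
move=> a b [[-> ->] a' /h[y' y'y le']|[S Sab hS] a' /(hS _ _ Sab)[b' b'b S']].
  by exists y' => //; right.
by exists b' => //; right; exists S.
Qed.

End Rank.

Lemma rank_le_trans (A B C : structure) (x : A) (y : B) (z : C) :
  rank_le x y -> rank_le y z -> rank_le x z.
Proof.
move=> [S Sxy hS] [T Tyz hT].
exists (fun a c => exists2 b, S a b & T b c); first by exists y.
move=> a c [b Sab Tbc] a' /(hS _ _ Sab)[b' /(hT _ _ Tbc)[c' cc' T'] S'].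
by exists c' => //; exists b'.
Qed.

(** If [x] is not simulated in [y], some [x'] in [x] is below no element of [y]; by induction every
    element of [y] then lies below an element of [x']. *)
Lemma rank_le_total (A B : structure) (x : A) (y : B) : wf A ->
  rank_le x y \/ exists2 x', x' ∈ x & rank_le y x'.
Proof.
move=> wfA; elim/(well_founded_ind wfA): x y => x IH y.
have [|nle] := pselect (rank_le x y); [by left|right].
have [x' [x'x hx']] : exists x', x' ∈ x /\ forall y', y' ∈ y -> ~ rank_le x' y'.
  apply: contrapT => h; apply: nle; apply/rank_leP => x' x'x.
  apply: contrapT => h'; apply: h; exists x'; split=> // y' y'y le'.
  by apply: h'; exists y'.
exists x' => //; apply/rank_leP => y' y'y.
by case: (IH _ x'x y') => [/hx'-/(_ y'y)|].
Qed.

Lemma rank_lt_irr (A : structure) (x x' : A) : wf A -> x' ∈ x -> ~ rank_le x x'.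
Proof.
move=> wfA; elim/(well_founded_ind wfA): x x' => x IH x' x'x /rank_leP /(_ _ x'x)[z zx'].
exact: IH.
Qed.

Lemma rank_le_depth (A B : structure) (x : A) (y : B) n :
  rank_le x y -> depth_ge n x -> depth_ge n y.
Proof.
elim: n x y => //= n IH x y /rank_leP h [x' /h[y' y'y le'] /(IH _ _ le')].
by exists y'.
Qed.

(** Descending from [y] while the rank stays at least that of [x] ends at an element of the same
    rank. *)
Lemma rank_eq_below (A B : structure) (x : A) (y y0 : B) : wf B ->
  rank_le x y -> y ∈ y0 ->
  exists z, [/\ clos_trans B (@mem_in B) z y0, rank_le x z & rank_le z x].
Proof.
move=> wfB; elim/(well_founded_ind wfB): y y0 => y IH y0 xy yy0.
case: (rank_le_total y x wfB) => [yx|[y' y'y xy']].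
  by exists y; split=> //; apply: t_step.
have [z [zy xz zx]] := IH _ y'y _ xy' y'y.
by exists z; split=> //; apply: t_trans zy (t_step _ _ _ _ yy0).
Qed.

(** * A tower of rich sets indexed by rank *)

Section TowerDef.
Variables (M : structure) (om : M).

(* [tower g w t]: [t] is the value at [(g, w)] of the recursion along the
   lexicographic order on pairs,
     T(g, w) = om ∪ ⋃ { Step (T (d, v)) | v ∈ om, (d, v) < (g, w) }. *)
Definition tower_node (r b p : M) := exists g, g ∈ b /\ exists w, w ∈ b /\
  exists t, t ∈ b /\ (is_triple p g w t /\ subs om t /\
  (forall d, d ∈ g -> forall v, v ∈ om -> exists t', t' ∈ b /\
     exists p', p' ∈ r /\ (is_triple p' d v t' /\ rich t' t)) /\
  (forall v, v ∈ om -> v ∈ w -> exists t', t' ∈ b /\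
     exists p', p' ∈ r /\ (is_triple p' g v t' /\ rich t' t)) /\
  (forall u, u ∈ t -> u ∈ om \/
     (exists d, d ∈ g /\ exists v, v ∈ om /\ exists t', t' ∈ b /\
        exists p', p' ∈ r /\ (is_triple p' d v t' /\ step u t')) \/
     (exists v, v ∈ om /\ (v ∈ w /\ exists t', t' ∈ b /\
        exists p', p' ∈ r /\ (is_triple p' g v t' /\ step u t'))))).

Definition tower_cert (r b : M) := forall p, p ∈ r -> tower_node r b p.

Definition tower (g w t : M) :=
  exists r b p, tower_cert r b /\ p ∈ r /\ is_triple p g w t.

End TowerDef.

Lemma D0_tower_cert (M : structure) i j k :
  D0 (fun e : nat -> M => tower_cert (e i) (e j) (e k)).
Proof. by rewrite /tower_cert /tower_node; d0. Qed.

Section Tower.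
Variables (M : structure) (KP : models_KP M) (om : M).

Lemma tower_node_mono r b r' b' p : subs r r' -> subs b b' ->
  tower_node om r b p -> tower_node om r' b' p.
Proof.
move=> rr bb [g [/bb gb [w [/bb wb [t [/bb tb [hp [ot [h1 [h2 h3]]]]]]]]]].
exists g; split=> //; exists w; split=> //; exists t; do 3!split=> //.
split=> [d dg v vo|].
  have [t' [/bb tb' [p' [/rr pr' h']]]] := h1 _ dg _ vo.
  by exists t'; split=> //; exists p'.
split=> [v vo vw|u /h3[|[]]]; first 1 last.
- by left.
- move=> [d [dg [v [vo [t' [/bb tb' [p' [/rr pr' h']]]]]]]].
  right; left; exists d; split=> //; exists v; split=> //.
  by exists t'; split=> //; exists p'.
- move=> [v [vo [vw [t' [/bb tb' [p' [/rr pr' h']]]]]]].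
  right; right; exists v; split=> //; split=> //.
  by exists t'; split=> //; exists p'.
have [t' [/bb tb' [p' [/rr pr' h']]]] := h2 _ vo vw.
by exists t'; split=> //; exists p'.
Qed.

Lemma towerE g w t : tower om g w t -> [/\ subs om t,
  forall d v, d ∈ g -> v ∈ om -> exists2 t', tower om d v t' & rich t' t,
  forall v, v ∈ om -> v ∈ w -> exists2 t', tower om g v t' & rich t' t &
  forall u, u ∈ t -> [\/ u ∈ om,
    exists d v t', [/\ d ∈ g, v ∈ om, tower om d v t' & step u t'] |
    exists v t', [/\ v ∈ om, v ∈ w, tower om g v t' & step u t']]].
Proof.
move=> [r [b [p [hr [pr hp]]]]].
have [g' [_ [w' [_ [t' [_ [hp' [ot [h1 [h2 h3]]]]]]]]]] := hr _ pr.
have [? ? ?] := triple_inj hp hp'; subst g' w' t'; split=> //.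
- move=> d v dg vo; have [t' [_ [p' [pr' [h' h'']]]]] := h1 _ dg _ vo.
  by exists t' => //; exists r, b, p'.
- move=> v vo vw; have [t' [_ [p' [pr' [h' h'']]]]] := h2 _ vo vw.
  by exists t' => //; exists r, b, p'.
- move=> u /h3[|[]]; first exact: Or31.
    move=> [d [dg [v [vo [t' [_ [p' [pr' [h' h'']]]]]]]]].
    by apply: Or32; exists d, v, t'; split=> //; exists r, b, p'.
  move=> [v [vo [vw [t' [_ [p' [pr' [h' h'']]]]]]]].
  by apply: Or33; exists v, t'; split=> //; exists r, b, p'.
Qed.

Hypothesis wfM : wf M.

(** Each element of one value stems from [om] or from an earlier value, over which the other value
    is rich too. *)
Lemma tower_unique g w t t' : tower om g w t -> tower om g w t' -> t = t'.
Proof.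
elim/(well_founded_ind wfM): g w t t' => g IHg w.
elim/(well_founded_ind wfM): w => w IHw t t' tt tt'.
have H x y : tower om g w x -> tower om g w y -> subs x y.
  move=> /towerE[_ _ _ hx] /towerE[oy y1 y2 _] u /hx.
  case=> [/oy //|[d [v [s [dg vo ts us]]]]|[v [s [vo vw ts us]]]].
    have [s' ts' rs'] := y1 d v dg vo.
    by have /(richP KP) := rs'; apply; rewrite -(IHg _ dg _ _ _ ts ts').
  have [s' ts' rs'] := y2 v vo vw.
  by have /(richP KP) := rs'; apply; rewrite -(IHw _ vw _ _ ts ts').
by apply: (ext KP) => u; split; apply: H.
Qed.

(** The induction is external, as [M] is well-founded. Certificates of earlier values are collected
    and merged as in [ex_gap]. *)
Lemma ex_tower g w : exists t, tower om g w t.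
Proof.
elim/(well_founded_ind wfM): g w => g IHg w.
elim/(well_founded_ind wfM): w => w IHw.
pose Q x d v := exists t, t ∈ x /\ exists r, r ∈ x /\ exists b, b ∈ x /\
  exists p, p ∈ r /\ (tower_cert om r b /\ is_triple p d v t).
have exQ d v : (exists t, tower om d v t) -> exists x, Q x d v.
  move=> [t [r [b [p [hr [pr hp]]]]]]; have [x [tx rx bx _]] := ex4 KP t r b b.
  exists x, t; split=> //; exists r; split=> //; exists b; split=> //.
  by exists p.
have [||Y1 hY1] := collection2 KP (P := fun e => exists t, t ∈ e 0 /\ exists r, r ∈ e 0 /\
    exists b, b ∈ e 0 /\ exists p, p ∈ r /\
    (tower_cert (e 3) r b /\ is_triple p (e 2) (e 1) t))
    (e := fun=> om) (a := g) (b := om).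
- by do !(apply: D0_tower_cert || apply: D0_triple || d0_step).
- by move=> d dg v _; apply: exQ; apply: IHg.
have [||Y2 hY2] := collection KP (P := fun e => e 1 ∈ e 3 ->
    exists t, t ∈ e 0 /\ exists r, r ∈ e 0 /\ exists b, b ∈ e 0 /\ exists p, p ∈ r /\
    (tower_cert (e 2) r b /\ is_triple p (e 4) (e 1) t))
    (e := scons om (scons w (fun=> g))) (a := om).
- by do !(apply: D0_tower_cert || apply: D0_triple || d0_step).
(* The collected formula is conditional on [v ∈ w], so [om] is a dummy witness otherwise. *)
- move=> v _ /=; have [vw|nvw] := pselect (v ∈ w); last by exists om.
  by have [x hx] := exQ _ _ (IHw _ vw); exists x.
have [Y hY] := ex_cup KP Y1 Y2.
have [U hU] := ex_bigcup KP Y; have [V hV] := ex_bigcup KP U.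
have [|R hR] := separation KP
    (P := fun e => exists r, r ∈ e 1 /\ (e 0 ∈ r /\ exists b, b ∈ e 1 /\
       tower_cert (e 2) r b)) (scons U (fun=> om)) V.
  by do !(apply: D0_tower_cert || d0_step).
(* Sets rich over the collected values bound all their steps, so that separation can form the new
   value [T]. *)
have [||Z hZ] := collection KP (P := fun e => rich (e 1) (e 0)) (e := fun=> om) (a := U).
- exact: D0_rich.
- by move=> x _; apply: ex_rich.
have [Big hBig] := ex_bigcup KP Z.
have [W hW] := ex_cup KP U V; have [T0 hT0] := ex_cup KP Big om.
have [|T hT] := separation KP (P := fun e => e 0 ∈ e 1 \/
     (exists d, d ∈ e 2 /\ exists v, v ∈ e 1 /\ exists t', t' ∈ e 4 /\
        exists p', p' ∈ e 5 /\ (is_triple p' d v t' /\ step (e 0) t')) \/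
     (exists v, v ∈ e 1 /\ (v ∈ e 3 /\ exists t', t' ∈ e 4 /\
        exists p', p' ∈ e 5 /\ (is_triple p' (e 2) v t' /\ step (e 0) t'))))
   (scons om (scons g (scons w (scons W (fun=> R))))) T0.
  by do !(apply: D0_triple || apply: D0_step || d0_step).
rewrite /= in hY1 hY2 hR hZ hT.
have [p hp] := ex_triple KP g w T.
have [R' [R1 [R2 pR']]] := ex_ins KP R p.
have [B0 [gB wB TB _]] := ex4 KP g w T T; have [B hB] := ex_cup KP B0 W.
have VB : subs V B by move=> x xV; apply/hB; right; apply/hW; right.
exists T, R', B, p; split=> // q /R1[/hR[qV [r [rU [qr [b [bU hb]]]]]]|->].
  apply: tower_node_mono (hb _ qr); last by move=> x /(hV _ _ bU) /VB.
  move=> x xr; apply/R2/hR; split; first exact: hV rU xr.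
  by exists r; split=> //; split=> //; exists b.
have QE x d v : x ∈ Y -> Q x d v -> exists t', [/\ t' ∈ U, t' ∈ W &
    exists p', [/\ p' ∈ R, is_triple p' d v t' & forall u, step u t' -> u ∈ T0]].
  move=> /hU xU [t' [/xU tU [r [/xU rU [b [/xU bU [p' [pr [hr hp']]]]]]]]].
  exists t'; split=> //; first by apply/hW; left.
  exists p'; split=> //.
    apply/hR; split; first exact: hV rU pr.
    by exists r; split=> //; split=> //; exists b.
  have [t2 [t2Z /(richP KP) ht2]] := hZ _ tU.
  by move=> u /ht2 ut2; apply/hT0; left; apply: hBig ut2.
exists g; split; first by apply/hB; left.
exists w; split; first by apply/hB; left.
exists T; split; first by apply/hB; left.
split=> //; split; first by move=> u uo; apply/hT; split; [apply/hT0; right|left].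
split; [|split].
- move=> d dg v vo; have [x [xY hx]] := hY1 _ dg _ vo.
  have [|t' [tU tW [p' [pR hp' hs]]]] := QE x d v _ hx; first by apply/hY; left.
  exists t'; split; first by apply/hB; right.
  exists p'; split; first exact: R2.
  split=> //; apply/(richP KP) => u us; apply/hT; split; first exact: hs.
  right; left; exists d; split=> //; exists v; split=> //; exists t'; split=> //.
  by exists p'.
- move=> v vo vw; have [x [xY /(_ vw) hx]] := hY2 _ vo.
  have [|t' [tU tW [p' [pR hp' hs]]]] := QE x g v _ hx; first by apply/hY; right.
  exists t'; split; first by apply/hB; right.
  exists p'; split; first exact: R2.
  split=> //; apply/(richP KP) => u us; apply/hT; split; first exact: hs.
  right; right; exists v; split=> //; split=> //; exists t'; split=> //.
  by exists p'.
- move=> u /hT[_ [|[]]]; first by left.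
    move=> [d [dg [v [vo [t' [tW [p' [pR h]]]]]]]]; right; left.
    exists d; split=> //; exists v; split=> //; exists t'; split.
      by apply/hB; right.
    by exists p'; split=> //; apply: R2.
  move=> [v [vo [vw [t' [tW [p' [pR h]]]]]]]; right; right.
  exists v; split=> //; split=> //; exists t'; split; first by apply/hB; right.
  by exists p'; split=> //; apply: R2.
Qed.

Lemma tower_below z g v w t t' : clos_trans M (@mem_in M) z g -> v ∈ om ->
  tower om z v t -> tower om g w t' -> rich t t'.
Proof.
move=> zg vo; elim: zg w t t' => {z g} [z g zg|x y z _ IH1 _ IH2] w t t' ht ht'.
  have [_ /(_ _ _ zg vo) [s hs st] _ _] := towerE ht'.
  by rewrite (tower_unique ht hs).
have [s hs] := ex_tower y v.
exact: rich_trans (IH1 _ _ _ ht hs) (IH2 _ _ _ hs ht').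
Qed.

(* T(g, w) depends on [g] only through its rank, so the grade of an element of the
   source structure can be any element of [M] of the same rank. *)
Lemma tower_rank g g' w t t' : rank_le g g' -> rank_le g' g ->
  tower om g w t -> tower om g' w t' -> t = t'.
Proof.
elim/(well_founded_ind (wf_clos_trans _ _ wfM)): g g' w t t' => g IHg g' w.
elim/(well_founded_ind wfM): w => w IHw t t' gg' g'g ht ht'.
have [ot t1 t2 t3] := towerE ht; have [ot' t1' t2' t3'] := towerE ht'.
apply: (ext KP) => u; split.
- move=> /t3[/ot' //|[d [v [s [dg vo ds us]]]]|[v [s [vo vw gs us]]]].
    have [d' d'g' dd'] := (rank_leP _ _).1 gg' _ dg.
    have [z [zg' dz zd]] := rank_eq_below wfM dd' d'g'.
    have [s' hs'] := ex_tower z v.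
    have /(richP KP) := tower_below zg' vo hs' ht'; apply.
    by rewrite -(IHg d _ z v s s') //; apply: t_step.
  have [s' hs'] := t2' v vo vw.
  by move/(richP KP); apply; rewrite -(IHw _ vw s s').
- move=> /t3'[/ot //|[d [v [s [dg vo ds us]]]]|[v [s [vo vw gs us]]]].
    have [d' d'g dd'] := (rank_leP _ _).1 g'g _ dg.
    have [z [zg dz zd]] := rank_eq_below wfM dd' d'g.
    have [s' hs'] := ex_tower z v.
    have /(richP KP) := tower_below zg vo hs' ht; apply.
    by rewrite (IHg z zg d v s' s).
  have [s' hs'] := t2 v vo vw.
  by move/(richP KP); apply; rewrite (IHw _ vw s' s).
Qed.

End Tower.

Definition height_le (A B : structure) := forall x : A, exists y : B, rank_le x y.

Lemma embeddable_height (A B : structure) : embeddable A B -> height_le A B.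
Proof.
move=> [j [_ hj]] x; exists (j x); exists (fun a b => b = j a) => // a b -> a' /hj aa'.
by exists (j a').
Qed.

Lemma height_leN (A B : structure) : wf A ->
  ~ height_le A B -> exists x : A, forall y : B, exists2 x', x' ∈ x & rank_le y x'.
Proof.
move=> wfA /existsNP[x nx]; exists x => y.
by case: (rank_le_total x y wfA) => // le; case: nx; exists y.
Qed.

Lemma height_le_total (A B : structure) : wf A -> height_le A B \/ height_le B A.
Proof.
move=> wfA; have [|/height_leN -/(_ wfA)[x hx]] := pselect (height_le A B); first by left.
by right=> y; have [x' _ yx'] := hx y; exists x'.
Qed.

Lemma well_founded_universal (M : structure) (KP : models_KP M) (x : M) :
  wf M -> infinite_depth x ->
  forall A : structure, countable [set: A] -> height_le A M -> embeddable A M.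
Proof.
move=> wfM hx A /countable_inj[c cI] AM.
have [om [n0 [l [n0om n0S lom lI ll]]]] := ex_labels KP hx.
have /choice[rho hrho] (a : A) : exists g : M, rank_le a g /\ rank_le g a.
  have [y ay] := AM a; elim/(well_founded_ind wfM): y ay => y IH ay.
  case: (rank_le_total y a wfM) => [|[y' /IH //]].
  by exists y.
(* The ∈-increasing sequence of the [n0 n] in [om] supplies the second coordinates, one for each
   link of the chain. *)
have /choice[t ht] (p : M * nat) := ex_tower KP om wfM p.1 (n0 p.2).
apply: (embeddable_of_rich KP (c := c) (t := fun a n => t (rho a, n)) (l := l)) => //.
- by move=> a i; have [ot _ _ _] := towerE (ht (rho a, 0)); apply: ot.
- move=> a n; have [_ _ h _] := towerE (ht (rho a, n.+1)).
  have [s hs] := h _ (n0om n) (n0S n).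
  by rewrite (tower_unique KP wfM (ht (rho a, n)) hs).
- move=> a b ab n; have [ra ra'] := hrho a; have [rb rb'] := hrho b.
  (* [rho a] need not lie below [rho b]; an element [z] of the same rank does, and has the same
     tower. *)
  have [g grb ag] := (rank_leP _ _).1 rb _ ab.
  have [z [zrb az za]] := rank_eq_below wfM ag grb.
  have [s hs] := ex_tower KP om wfM z (n0 n).
  rewrite (tower_rank KP wfM _ _ (ht (rho a, n)) hs).
  + exact: tower_below (hs) (ht (rho b, 0)).
  + exact: rank_le_trans ra' az.
  + exact: rank_le_trans za ra.
Qed.

(** * Models without elements of infinite depth *)

Section FiniteDepth.
Variables (N : structure) (KPN : models_KP N).

(** By extensionality an element at the next level is determined by a subset of the list obtained so
    far, coded as a boolean mask. *)
Lemma finite_bounded_depth n :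
  exists s : seq {classic N}, forall x : N, ~ depth_ge n x -> x \in (s : seq {classic N}).
Proof.
elim: n => [|n [s hs]]; first by exists [::] => x /(_ I).
have /choice[g hg] (m : (size s).-tuple bool) : exists x : N,
    (exists x : N, forall y : N, y ∈ x <-> (y : {classic N}) \in mask m s) ->
    forall y : N, y ∈ x <-> (y : {classic N}) \in mask m s.
  have [[x hx]|h] := pselect (exists x : N, forall y : N,
      y ∈ x <-> (y : {classic N}) \in mask m s); first by exists x.
  by have [x] := KP_nonempty KPN; exists x.
exists [seq (g m : {classic N}) | m <- enum {: (size s).-tuple bool}] => x hx.
pose a (y : {classic N}) := `[< (y : N) ∈ x >].
have sz : size (map a s) == size s by rewrite size_map.
have hm (y : N) : y ∈ x <-> (y : {classic N}) \in mask (Tuple sz) s.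
  rewrite /= -filter_mask mem_filter; split=> [yx|/andP[/asboolP//]].
  apply/andP; split; first exact/asboolP.
  by apply: hs => hy; apply: hx; exists y.
apply/mapP; exists (Tuple sz); first by rewrite mem_enum.
apply: (ext KPN) => y; rewrite hm; symmetry.
by apply: hg; exists x.
Qed.

(** Every element has finitely many members, so the set of their images can be formed in [M] by
    insertions. *)
Lemma embeddable_finite_depth (M : structure) : models_KP M -> wf N ->
  (forall x : N, ~ infinite_depth x) -> embeddable N M.
Proof.
move=> KP wfN hN; have [e he] := ex_empty KP.
have [||j hj] := @well_founded_choice N M (@mem_in N) e
    (fun x f y => forall z, z ∈ y <-> exists2 u, u ∈ x & z = f u) wfN.
- move=> x f g y fg h z; rewrite h.
  by split=> -[u ux ->]; exists u => //; rewrite fg.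
- move=> x f _; have [n hn] : exists n, ~ depth_ge n x.
    by apply: contrapT => h; apply: (hN x) => n; apply: contrapT => hn; apply: h; exists n.
  have [s hs] : exists s : seq {classic N}, forall u : N, u ∈ x -> (u : {classic N}) \in s.
    case: n hn => [/(_ I)//|n] hn; have [s hs] := finite_bounded_depth n.
    by exists s => u ux; apply: hs => hu; apply: hn; exists u.
  have {hn} [y hy] : exists y : M, forall z, z ∈ y <->
      exists2 u : N, u ∈ x /\ (u : {classic N}) \in s & z = f u.
    elim: s {hs} => [|u s [y hy]].
      by exists e => z; split=> [/he|[u []]].
    have [ux|nux] := pselect (u ∈ x); last first.
      exists y => z; rewrite hy; split=> -[v [vx vs] ->]; exists v; split=> //.
        by rewrite inE vs orbT.
      by move: vs; rewrite inE => /predU1P[vu|//]; case: nux; rewrite -vu.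
    have [y' [h1 [h2 h3]]] := ex_ins KP y (f u).
    exists y' => z; split=> [/h1[/hy[v [vx vs] ->]|->]|[v [vx]]].
    - by exists v; split=> //; rewrite inE vs orbT.
    - by exists u; split=> //; rewrite mem_head.
    - rewrite inE => /predU1P[-> ->//|vs ->]; apply/h2/hy.
      by exists v.
  exists y => z; rewrite hy; split=> [[u [ux _] ->]|[u ux ->]]; first by exists u.
  by exists u => //; split=> //; apply: hs.
have jI : injective j.
  elim/(well_founded_ind wfN) => x IH y xy; apply: (ext KPN) => z; split=> hz.
    have : j z ∈ j y by rewrite -xy; apply/hj; exists z.
    by move=> /hj[u uy /(IH _ hz) ->].
  have : j z ∈ j x by rewrite xy; apply/hj; exists z.
  by move=> /hj[u ux zu]; rewrite -(IH _ ux _ (esym zu)).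
exists j; split=> // x y; split=> [xy|/hj[u uy /jI -> //]].
by apply/hj; exists x.
Qed.

End FiniteDepth.

Lemma embeddable_wf (A M : structure) : models_KP A -> models_KP M ->
  countable [set: A] -> wf A -> wf M -> height_le A M -> embeddable A M.
Proof.
move=> KPA KPM cA wfA wfM AM.
have [[a ha]|h] := pselect (exists a : A, infinite_depth a).
  have [x ax] := AM a; apply: (well_founded_universal KPM (x := x)) => // n.
  exact: rank_le_depth ax (ha n).
by apply: embeddable_finite_depth => // a ha; apply: h; exists a.
Qed.

Lemma descending_sequence (M : structure) : ~ wf M ->
  exists g : nat -> M, forall n, g n.+1 ∈ g n.
Proof.
move=> /existsNP[x nx].
have /choice[h hh] (y : {y : M | ~ Acc (@mem_in M) y}) :
    exists z : {y : M | ~ Acc (@mem_in M) y}, sval z ∈ sval y.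
  case: y => y ny /=; apply: contrapT => hz; apply: ny; constructor => z zy.
  by apply: contrapT => nz; apply: hz; exists (exist _ z nz).
by exists (fun n => sval (iter n h (exist _ x nx))) => n; apply: hh.
Qed.

Lemma wf_no_descent (M : structure) (g : nat -> M) : wf M -> ~ forall n, g n.+1 ∈ g n.
Proof.
move=> wfM hg; suff H x n : g n <> x by apply: (H (g 0) 0).
elim/(well_founded_ind wfM): x n => x IH n e.
by apply: (IH (g n.+1) _ n.+1 erefl); rewrite -e.
Qed.

Lemma embeddable_ill_founded (A M : structure) : models_KP A -> models_KP M ->
  countable [set: A] -> ~ wf M -> embeddable A M.
Proof.
move=> KPA KPM cA /descending_sequence[g hg].
by apply: (ill_founded_universal KPM hg) => // a; apply: mem_acyclic.
Qed.

Lemma embeddable_total (M N : structure) : models_KP M -> models_KP N ->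
  countable [set: M] -> countable [set: N] -> embeddable M N \/ embeddable N M.
Proof.
move=> KM KN cM cN.
have [wM|nM] := pselect (wf M); last by right; apply: embeddable_ill_founded.
have [wN|nN] := pselect (wf N); last by left; apply: embeddable_ill_founded.
by have [h|h] := height_le_total N wM; [left|right]; apply: embeddable_wf.
Qed.

Lemma wf_embeddable (M N : structure) : embeddable M N -> wf N -> wf M.
Proof.
move=> [j [_ hj]] wN; apply: contrapT => /descending_sequence[g hg].
by apply: (@wf_no_descent _ (j \o g) wN) => n /=; apply/hj.
Qed.

(** * The downward Loewenheim-Skolem theorem *)

Fixpoint fv_bound (p : formula) : nat :=
  match p with
  | FMem i j | FEq i j => maxn i.+1 j.+1
  | FBot => 0
  | FAnd p q | FOr p q | FImp p q => maxn (fv_bound p) (fv_bound q)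
  | FAll p | FEx p => (fv_bound p).-1
  end.

Lemma sat_agree (M : structure) p (e e' : nat -> M) :
  (forall i, i < fv_bound p -> e i = e' i) -> sat p e <-> sat p e'.
Proof.
elim: p e e' => [i j|i j||p hp q hq|p hp q hq|p hp q hq|p hp|p hp] e e' /= h //.
- by rewrite !h // leq_max leqnn ?orbT.
- by rewrite !h // leq_max leqnn ?orbT.
- by rewrite (hp e e') ?(hq e e') // => i ip; apply: h; rewrite leq_max ip ?orbT.
- by rewrite (hp e e') ?(hq e e') // => i ip; apply: h; rewrite leq_max ip ?orbT.
- by rewrite (hp e e') ?(hq e e') // => i ip; apply: h; rewrite leq_max ip ?orbT.
all: have E x : sat p (scons x e) <-> sat p (scons x e')
  by apply: hp => -[//|i] ip; apply: h; rewrite -ltnS (leq_trans ip) ?leqSpred.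
- by split=> H x; apply/E.
- by split=> -[x /E H]; exists x.
Qed.

(** Trees over [nat] are countable, so this injection numbers the formulas. *)
Fixpoint tree_of_formula (p : formula) : GenTree.tree nat :=
  match p with
  | FMem i j => GenTree.Node 0 [:: GenTree.Leaf i; GenTree.Leaf j]
  | FEq i j => GenTree.Node 1 [:: GenTree.Leaf i; GenTree.Leaf j]
  | FBot => GenTree.Node 2 [::]
  | FAnd p q => GenTree.Node 3 [:: tree_of_formula p; tree_of_formula q]
  | FOr p q => GenTree.Node 4 [:: tree_of_formula p; tree_of_formula q]
  | FImp p q => GenTree.Node 5 [:: tree_of_formula p; tree_of_formula q]
  | FAll p => GenTree.Node 6 [:: tree_of_formula p]
  | FEx p => GenTree.Node 7 [:: tree_of_formula p]
  end.

Lemma tree_of_formula_inj : injective tree_of_formula.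
Proof.
elim=> [i j|i j||p hp q hq|p hp q hq|p hp q hq|p hp|p hp] [] //=.
- by move=> ? ? [-> ->].
- by move=> ? ? [-> ->].
- by move=> ? ? [/hp-> /hq->].
- by move=> ? ? [/hp-> /hq->].
- by move=> ? ? [/hp-> /hq->].
- by move=> ? [/hp->].
- by move=> ? [/hp->].
Qed.

Definition elementary (H M : structure) (i : H -> M) :=
  forall p e, sat p e <-> sat p (i \o e).

(** Each existence statement becomes a formula, with scheme instances renamed to make room, and
    elementarity pulls its witness back to [H]. *)
Lemma models_KP_elementary (H M : structure) (i : H -> M) :
  elementary i -> inhabited H -> models_KP M -> models_KP H.
Proof.
move=> el [h0] KP.
have memE x y : x ∈ y <-> i x ∈ i y := el (FMem 0 1) (scons x (fun=> y)).
have icons x e : i \o scons x e = scons (i x) (i \o e) by apply/funext; case.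
have exH p e : sat (FEx p) (i \o e) -> exists x, sat p (scons x e).
  by move=> /el.
have renE r p (e f : nat -> H) : (forall n, e (r n) = f n) ->
    sat (ren r p) e <-> sat p f.
  by move=> ef; rewrite sat_ren (_ : (fun n => e (r n)) = f) //; apply/funext.
have renM r p (e f : nat -> M) : (forall n, e (r n) = f n) ->
    sat (ren r p) e <-> sat p f.
  by move=> ef; rewrite sat_ren (_ : (fun n => e (r n)) = f) //; apply/funext.
split=> //.
- move=> x y xy; apply: contrapT => nxy.
  have := el (FEq 0 1) (scons x (fun=> y)); rewrite /= => ixy.
  apply/nxy/ixy/(ext KP) => z; apply: contrapT => nz.
  have [|u] := exH (FImp (FAnd (FImp (FMem 0 1) (FMem 0 2))
      (FImp (FMem 0 2) (FMem 0 1))) FBot) (scons x (scons y (fun=> x))).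
    by exists z => -[/= h1 h2]; apply: nz.
  by apply; case: (xy u).
- move=> p e [x hx].
  pose r n := if n is k.+1 then k.+2 else 0.
  have [|z [pz hz]] := KP_foundation KP (phi := p) (e := i \o e).
    by exists (i x); rewrite -icons; apply/el.
  have [|u [pu hu]] := exH (FAnd p (FAll (FImp (FMem 0 1) (FImp (ren r p) FBot)))) e.
    exists z; split=> // y yz /(renM _ _ _ (scons y (i \o e))) h.
    by apply: hz yz _; apply: h => -[].
  exists u; split=> // y yu py; apply: (hu y) => //.
  by apply/(renE _ _ _ (scons y e)) => // -[].
- move=> x y; apply: (exH (FAnd (FMem 1 0) (FMem 2 0)) (scons x (scons y (fun=> x)))).
  by have [z hz] := KP_pairing KP (i x) (i y); exists z.
- move=> a; apply: (exH (FAll (FAll (FImp (FMem 1 3) (FImp (FMem 0 1) (FMem 0 2)))))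
    (fun=> a)).
  by have [b hb] := KP_union KP (i a); exists b => x y; apply: hb.
- move=> p dp e a; pose r n := if n is k.+1 then k.+3 else 0.
  have [|b hb] := exH (FAll (FAnd (FImp (FMem 0 1) (FAnd (FMem 0 2) (ren r p)))
     (FImp (FAnd (FMem 0 2) (ren r p)) (FMem 0 1)))) (scons a e).
    have [b hb] := KP_Delta0_separation KP dp (i \o e) (i a); exists b => x.
    have E : sat (ren r p) (scons x (scons b (i \o scons a e))) <->
      sat p (scons x (i \o e)) by apply: renM => -[].
    by split=> /= [/hb[? /E]|[? /E ?]]; [|apply/hb].
  exists b => x; have [h1 h2] := hb x.
  have E : sat (ren r p) (scons x (scons b (scons a e))) <->
    sat p (scons x e) by apply: renE => -[].
  by split=> [/h1[/= ? /E]|[? /E ?]]; [|apply: h2].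
- move=> p dp e a hx.
  (* [r1] skips the variable of [a]; [r2] also skips that of the bound. *)
  pose r1 n := if n is k.+2 then k.+3 else n.
  pose r2 n := if n is k.+2 then k.+4 else n.
  have : sat (FAll (FImp (FMem 0 1) (FEx (ren r1 p)))) (i \o scons a e).
    apply/el => x /= /hx[y hy]; exists y.
    by apply/(renE _ _ _ (scons y (scons x e))) => // -[|[]].
  move=> hM; have [|b hb] := KP_Delta0_collection KP dp (e := i \o e) (a := i a).
    move=> x /(hM x)[y hy]; exists y.
    by move: hy => /(renM _ _ _ (scons y (scons x (i \o e)))); apply => -[|[]].
  have [|c hc] := exH (FAll (FImp (FMem 0 2) (FEx (FAnd (FMem 0 2) (ren r2 p))))) (scons a e).
    exists b => x /= /hb[y [yb hy]]; exists y; split=> //.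
    by apply/(renM _ _ _ (scons y (scons x (i \o e)))) => // -[|[]].
  exists c => x xa; have [y [yc hy]] := hc x xa; exists y; split=> //.
  by move: hy => /(renE _ _ _ (scons y (scons x e))); apply => -[|[]].
Qed.

Definition sub_structure (M : structure) (H : set M) : structure :=
  @Structure {x : M | H x} (fun x y => sval x ∈ sval y).

(* The hull consists of the values of the Skolem terms, coded as finite trees:
   leaves name the given elements and a node labelled by the code of [p] picks
   a witness for [FEx p], the environment being read off the subterms. *)
Lemma downward_Loewenheim_Skolem (M : structure) (a : nat -> M) :
  exists2 H : set M, countable H &
    (forall n, H (a n)) /\ elementary (fun x : sub_structure H => sval x).
Proof.
pose env (l : seq M) n := nth (a 0) l n.
have /choice[F hF] (nl : nat * seq M) : exists x, forall p,
    pickle (tree_of_formula p) = nl.1 ->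
    sat (FEx p) (env nl.2) -> sat p (scons x (env nl.2)).
  case: nl => n l /=.
  have [[p [pn [x hx]]]|h] := pselect (exists p, pickle (tree_of_formula p) = n /\
      sat (FEx p) (env l)).
    exists x => q; rewrite -pn => /(pcan_inj pickleK) /tree_of_formula_inj -> _.
    exact: hx.
  by exists (a 0) => p pn hp; case: h; exists p.
pose fix eval (t : GenTree.tree nat) : M := match t with
  | GenTree.Leaf n => a n
  | GenTree.Node n ts => F (n, map eval ts) end.
exists (range eval).
  by apply: sub_countable (countableP [set: GenTree.tree nat]); apply: card_image_le.
split; first by move=> n; exists (GenTree.Leaf n).
set H := range eval.
have closed (l : seq M) p : (forall x, List.In x l -> H x) ->
    sat (FEx p) (env l) -> exists2 x, H x & sat p (scons x (env l)).
  move=> hl hp; exists (F (pickle (tree_of_formula p), l)); last exact: (hF (_, _)).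
  have [ts <-] : exists ts, map eval ts = l.
    elim: l hl {hp} => [|x l IH] hl; first by exists [::].
    have [t _ tx] : H x by apply: hl; left.
    have [|ts <-] := IH; first by move=> y yl; apply: hl; right.
    by exists (t :: ts); rewrite /= tx.
  by exists (GenTree.Node (pickle (tree_of_formula p)) ts).
have witness p (e : nat -> sub_structure H) : sat (FEx p) (fun n => sval (e n)) ->
    exists x : sub_structure H, sat p (scons (sval x) (fun n => sval (e n))).
  (* Only finitely many values of the environment matter, so a list can replace it. *)
  pose l := [seq sval (e n) | n <- iota 0 (fv_bound p)].
  have lE n : n < fv_bound p -> env l n = sval (e n).
    by move=> np; rewrite /env (nth_map 0) ?size_iota // nth_iota.
  have E x : sat p (scons x (fun n => sval (e n))) <-> sat p (scons x (env l)).
    by apply: sat_agree => -[//|n] /ltnW /lE /= ->.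
  move=> [x /E hx]; have [||y Hy /E hy] := closed l p.
  - move=> y; rewrite /l; elim: (iota _ _) => //= n s IH [<-|/IH//].
    exact: svalP.
  - by exists x.
  - by exists (exist _ y Hy).
move=> p e; rewrite /comp.
elim: p e => [i j|i j||p hp q hq|p hp q hq|p hp q hq|p hp|p hp] e /=.
- by [].
- by split=> [-> //|]; case: (e i) (e j) => x hx [y hy] /= xy; apply: eq_exist.
- by [].
- by rewrite hp hq.
- by rewrite hp hq.
- by rewrite hp hq.
all: have E x : sat p (scons x e) <-> sat p (scons (sval x) (fun n => sval (e n)))
  by rewrite hp (_ : (fun n => _) = scons (sval x) (fun n => sval (e n))) //;
     apply/funext; case.
- split=> h x; last exact/E/h.
  apply: contrapT => nx; have [|y] := witness (FImp p FBot) e; first by exists x.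
  by apply; apply/E/h.
- by split=> [[x /E hx]|/witness[x /E hx]]; [exists (sval x)|exists x].
Qed.

Lemma countable_KP_hull (M : structure) (a : nat -> M) : models_KP M ->
  exists H : set M, [/\ models_KP (sub_structure H),
    countable [set: sub_structure H] & forall n, H (a n)].
Proof.
move=> KP; have [H cH [aH el]] := downward_Loewenheim_Skolem a.
exists H; split=> //.
  by apply: models_KP_elementary el _ KP; split; exists (a 0).
have /countable_injP[c cI] := cH.
apply/countable_injP; exists (fun x : sub_structure H => c (sval x)).
move=> [x hx] [y hy] _ _ /= /cI xy; apply: eq_exist; apply: xy; exact: mem_set.
Qed.

(** * An ill-founded model *)

Local Open Scope classical_set_scope.

(** The representative is chosen from the predicate [R x], which is the same for equivalent
    elements; this stands in for a quotient. *)
Lemma canonical_representatives (T : Type) (x0 : T) (R : T -> T -> Prop) :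
  (forall x, R x x) -> (forall x y, R x y -> R y x) ->
  (forall x y z, R x y -> R y z -> R x z) ->
  exists c : T -> T, (forall x, R x (c x)) /\ forall x y, R x y -> c x = c y.
Proof.
move=> Rr Rs Rt.
have /choice[g hg] (P : T -> Prop) : exists y, (exists x, P x) -> P y.
  by have [[x Px]|h] := pselect (exists x, P x); [exists x|exists x0].
exists (fun x => g (R x)); split=> [x|x y xy]; first by apply: hg; exists x.
by congr g; apply/predeqP => z; split; apply: Rt => //; apply: Rs.
Qed.

(** * Ultrapowers *)

Section Ultrapower.
Variables (M : structure) (KP : models_KP M) (U : set_system nat).
Hypothesis UU : UltraFilter U.

Let eqU (f g : nat -> M) := U [set n | f n = g n].

Let ultra (A : set nat) : ~ U A <-> U (~` A).
Proof.
split=> [nA|UA UA']; first by have [//|] := in_ultra_setVsetC A UU.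
by apply: (@filter_not_empty _ U _); rewrite -(setICr A); apply: filterI.
Qed.

Lemma ultrapower_exists : exists (N : structure) (q : (nat -> M) -> N) (r : N -> nat -> M),
  [/\ forall f, U [set n | r (q f) n = f n],
      forall x y, U [set n | r x n = r y n] -> x = y &
      forall x y : N, x ∈ y <-> U [set n | r x n ∈ r y n]].
Proof.
have [x0] := KP_nonempty KP.
have [|||c [c1 c2]] := @canonical_representatives (nat -> M) (fun=> x0) eqU.
- by move=> f; rewrite /eqU; apply: filterS filterT.
- by move=> f g; apply: filterS => n /= ->.
- by move=> f g h fg gh; apply: filterS2 fg gh => n /= -> ->.
have cc f : c (c f) = c f by symmetry; apply: c2.
exists (@Structure {f | c f = f} (fun f g => U [set n | sval f n ∈ sval g n])).
exists (fun f => exist (fun f => c f = f) (c f) (cc f)), sval; split=> //.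
- by move=> f /=; apply: filterS (c1 f) => n /= ->.
- by move=> [x hx] [y hy] /= /c2; rewrite hx hy => xy; apply: eq_exist.
Qed.

Variables (N : structure) (q : (nat -> M) -> N) (r : N -> nat -> M).
Hypothesis rq : forall f, U [set n | r (q f) n = f n].
Hypothesis r_inj : forall x y, U [set n | r x n = r y n] -> x = y.
Hypothesis memU : forall x y : N, x ∈ y <-> U [set n | r x n ∈ r y n].

Let rcons_ x (e : nat -> N) n :
  (fun i => r (scons x e i) n) = scons (r x n) (fun i => r (e i) n).
Proof. by apply/funext; case. Qed.

Lemma Los p (e : nat -> N) : sat p e <-> U [set n | sat p (fun i => r (e i) n)].
Proof.
have ultra_imp (A B : set nat) : (U A -> U B) -> U [set n | A n -> B n].
  move=> AB; have [/AB|/ultra] := pselect (U A); apply: filterS => n //= Bn.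
have exU (P : nat -> M -> Prop) : U [set n | exists x, P n x] ->
    exists x : N, U [set n | P n (r x n)].
  have [x0] := KP_nonempty KP.
  have /choice[f hf] n : exists x, (exists y, P n y) -> P n x.
    by have [[x Px]|h] := pselect (exists x, P n x); [exists x|exists x0].
  move=> h; exists (q f); apply: filterS2 (rq f) h => n /= -> [x Px].
  by apply: hf; exists x.
elim: p e => [i j|i j||p hp k hk|p hp k hk|p hp k hk|p hp|p hp] e /=.
- exact: memU.
- by split=> [->|/r_inj //]; apply: filterS filterT.
- by split=> // h; apply: (@filter_not_empty _ U _); apply: filterS h.
- rewrite hp hk; split=> [[]|h]; first by apply: filterS2.
  by split; apply: filterS h => n [].
- rewrite hp hk; split=> [[]|h];
    [by apply: filterS => n; left|by apply: filterS => n; right|].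
  have [|/ultra np] := pselect (U [set n | sat p (fun i => r (e i) n)]); [by left|right].
  by apply: filterS2 np h => n /= np [].
- rewrite hp hk; split=> [|h]; first exact: ultra_imp.
  by move=> hU; apply: filterS2 h hU => n /=; apply.
- split=> h.
    apply: contrapT => /ultra nh.
    have [|x hx] := exU (fun n x => ~ sat p (scons x (fun i => r (e i) n))).
      by apply: filterS nh => n /= /existsNP.
    have /hp := h x; apply/ultra; apply: filterS hx => n /=.
    by rewrite rcons_.
  move=> x; apply/hp; apply: filterS h => n /= h; rewrite rcons_; exact: h.
- split=> [[x /hp hx]|/exU[x hx]].
    by apply: filterS hx => n /= hx; exists (r x n); rewrite -rcons_.
  by exists x; apply/hp; apply: filterS hx => n /=; rewrite rcons_.
Qed.

(** For each axiom [pick] chooses a witness at every index where there is one, and [Los] translates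
    the formulas. *)
Lemma models_KP_ultrapower : models_KP N.
Proof.
have [x0] := KP_nonempty KP.
have pick (P : nat -> M -> Prop) : exists x : N,
    U [set n | (exists y, P n y) -> P n (r x n)].
  have /choice[f hf] n : exists x, (exists y, P n y) -> P n x.
    by have [[x Px]|h] := pselect (exists x, P n x); [exists x|exists x0].
  exists (q f); apply: filterS (rq f) => n /= ->; exact: hf.
have Los1 p x (e : nat -> N) : sat p (scons x e) <->
    U [set n | sat p (scons (r x n) (fun i => r (e i) n))].
  by rewrite Los; split; apply: filterS => n /=; rewrite rcons_.
have Los2 p y x (e : nat -> N) : sat p (scons y (scons x e)) <->
    U [set n | sat p (scons (r y n) (scons (r x n) (fun i => r (e i) n)))].
  by rewrite Los1; split; apply: filterS => n /=; rewrite rcons_.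
split.
- by split; exact: q (fun=> x0).
- move=> x y xy; apply: r_inj; apply: contrapT => /ultra nxy.
  have [z hz] := pick (fun n z => ~ (z ∈ r x n <-> z ∈ r y n)).
  have {}hz : U [set n | ~ (r z n ∈ r x n <-> r z n ∈ r y n)].
    apply: filterS2 hz nxy => n /= hz nxy; apply: hz; apply: contrapT => nh.
    by apply: nxy; apply: (ext KP) => z'; apply: contrapT => nz; apply: nh; exists z'.
  have [/memU zx|/ultra nzx] := pselect (U [set n | r z n ∈ r x n]).
    have /memU zy := (xy z).1 zx; have /memU {}zx := zx.
    apply: (@filter_not_empty _ U _).
    by apply: filterS3 zx zy hz => n /= ? ? [].
  have [/memU/xy/memU zx|/ultra nzy] := pselect (U [set n | r z n ∈ r y n]).
    apply: (@filter_not_empty _ U _).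
    by apply: filterS2 zx nzx.
  apply: (@filter_not_empty _ U _).
  by apply: filterS3 nzx nzy hz => n /= ? ? [].
- move=> p e [x /Los1 hx].
  have [z hz] := pick (fun n z => sat p (scons z (fun i => r (e i) n)) /\
    forall y, y ∈ z -> ~ sat p (scons y (fun i => r (e i) n))).
  have {}hz : U [set n | sat p (scons (r z n) (fun i => r (e i) n)) /\
      forall y, y ∈ r z n -> ~ sat p (scons y (fun i => r (e i) n))].
    apply: filterS2 hx hz => n /= hx; apply; apply: (KP_foundation KP).
    by exists (r x n).
  exists z; split; first by apply/Los1; apply: filterS hz => n [].
  move=> y /memU yz /Los1 hy; apply: (@filter_not_empty _ U _).
  by apply: filterS3 yz hy hz => n /= yz hy [_ /(_ _ yz)].
- move=> x y; have [z hz] := pick (fun n z => r x n ∈ z /\ r y n ∈ z).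
  by exists z; split; apply/memU; apply: filterS hz => n /=;
     case=> //; apply: (KP_pairing KP).
- move=> a; have [b hb] := pick (fun n b => forall x y, x ∈ r a n -> y ∈ x -> y ∈ b).
  exists b => x y /memU xa /memU yx; apply/memU; apply: filterS3 xa yx hb => n /= xa yx.
  by move=> /(_ (KP_union KP _)) h; apply: h xa yx.
- move=> p dp e a.
  have [b hb] := pick (fun n b => forall x, x ∈ b <->
    x ∈ r a n /\ sat p (scons x (fun i => r (e i) n))).
  have {}hb : U [set n | forall x, x ∈ r b n <->
      x ∈ r a n /\ sat p (scons x (fun i => r (e i) n))].
    by apply: filterS hb => n; apply; apply: (KP_Delta0_separation KP).
  exists b => x; split.
    move=> /memU xb; split; [apply/memU|apply/Los1];
    by apply: filterS2 xb hb => n /= xb /(_ (r x n)) /iffLR /(_ xb) [].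
  move=> [/memU xa /Los1 hx]; apply/memU; apply: filterS3 xa hx hb => n /= xa hx hb.
  exact/hb.
- move=> p dp e a hx.
  have [b hb] := pick (fun n b => forall x, x ∈ r a n -> exists y, y ∈ b /\
    sat p (scons y (scons x (fun i => r (e i) n)))).
  have h : U [set n | forall x, x ∈ r a n -> exists y,
      sat p (scons y (scons x (fun i => r (e i) n)))].
    apply: contrapT => /ultra nh.
    have [x hx'] := pick (fun n x => x ∈ r a n /\
      ~ exists y, sat p (scons y (scons x (fun i => r (e i) n)))).
    have {}hx' : U [set n | r x n ∈ r a n /\
        ~ exists y, sat p (scons y (scons (r x n) (fun i => r (e i) n)))].
      apply: filterS2 hx' nh => n /= h1 h2; apply: h1; apply: contrapT => h3.
      by apply: h2 => x' x'a; apply: contrapT => h4; apply: h3; exists x'.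
    have [|y /Los2 hy] := hx x; first by apply/memU; apply: filterS hx' => n [].
    apply: (@filter_not_empty _ U _); apply: filterS2 hy hx' => n /= hy [_]; apply.
    by exists (r y n).
  have {h}hb : U [set n | forall x, x ∈ r a n -> exists y, y ∈ r b n /\
    sat p (scons y (scons x (fun i => r (e i) n)))].
    by apply: filterS2 h hb => n /= h; apply; apply: (KP_Delta0_collection KP).
  exists b => x /memU xa.
  have [y hy] := pick (fun n y => y ∈ r b n /\
    sat p (scons y (scons (r x n) (fun i => r (e i) n)))).
  have {}hy : U [set n | r y n ∈ r b n /\
      sat p (scons (r y n) (scons (r x n) (fun i => r (e i) n)))].
    by apply: filterS3 xa hb hy => n /= xa hb; apply; apply: hb.
  by exists y; split; [apply/memU|apply/Los2]; apply: filterS hy => n [].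
Qed.

End Ultrapower.

Lemma ill_founded_KP (M : structure) (z : nat -> M) : models_KP M ->
  (forall n, z n ∈ z n.+1) ->
  exists2 N : structure, models_KP N & exists g : nat -> N, forall k, g k.+1 ∈ g k.
Proof.
move=> KP hz; have [U [UU Uoo]] := @ultraFilterLemma nat eventually _.
have [N [q [r [rq r_inj memU]]]] := ultrapower_exists KP UU.
exists N; first exact: models_KP_ultrapower rq r_inj memU.
(* Truncated subtraction is harmless: [U] contains the set of all [n] greater than [k], where
   [z (n - k.+1) ∈ z (n - k)]. *)
exists (fun k => q (fun n => z (n - k))) => k; apply/memU.
have lt_k : U [set n | k < n] by apply: Uoo; exists k.+1.
apply: filterS3 (rq (fun n => z (n - k.+1))) (rq (fun n => z (n - k))) lt_k => n /= -> -> kn.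
by rewrite -(subnSK kn); apply: hz.
Qed.

(** * Well-founded models of arbitrarily large countable height *)

Lemma models_KP_of_small_sets (S : structure) :
  (forall x y : S, (forall z, z ∈ x <-> z ∈ y) -> x = y) -> wf S ->
  (forall s : S, exists p : {A : Set & A -> S}, forall x, x ∈ s <->
    exists a, x = projT2 p a) ->
  (forall (A : Set) (g : A -> S), exists s, forall x, x ∈ s <-> exists a, x = g a) ->
  models_KP S.
Proof.
move=> hext hwf small sup; split=> //.
- by have [s _] := sup Empty_set (fun a : Empty_set => match a with end); exists.
- move=> p e [x px]; elim/(well_founded_ind hwf): x px => x IH px.
  have [[y [yx py]]|h] := pselect (exists y, y ∈ x /\ sat p (scons y e)).
    exact: IH yx py.
  by exists x; split=> // y yx py; apply: h; exists y.
- move=> x y; have [s hs] := sup bool (fun b => if b then x else y).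
  by exists s; split; apply/hs; [exists true|exists false].
- move=> a; have /choice[f hf] := small.
  have [s hs] := sup {i : projT1 (f a) & projT1 (f (projT2 (f a) i))}
    (fun k => projT2 (f _) (projT2 k)).
  exists s => x y /hf[i ->] /hf[j ->]; apply/hs.
  by exists (existT _ i j).
- move=> p dp e a; have [[A g] /= hg] := small a.
  have [s hs] := sup {i : A | sat p (scons (g i) e)} (fun k => g (sval k)).
  exists s => x; rewrite hs; split=> [[[i hi] ->]|[/hg[i ->] hi]].
    by split=> //; apply/hg; exists i.
  by exists (exist _ i hi).
- move=> p dp e a hx; have [[A g] /= hg] := small a.
  have /choice[h hh] (i : A) : exists y, sat p (scons y (scons (g i) e)).
    by apply: hx; apply/hg; exists i.
  have [s hs] := sup A h; exists s => x /hg[i ->]; exists (h i); split=> //.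
  by apply/hs; exists i.
Qed.

(* Trees with branching types in [Set], which is closed under the sums and subtypes
   that union, separation and collection require. *)
Inductive iset : Type := Sup (A : Set) (f : A -> iset).

Fixpoint iset_eq (x y : iset) : Prop :=
  match x, y with Sup A f, Sup B g =>
    (forall a, exists b, iset_eq (f a) (g b)) /\
    (forall b, exists a, iset_eq (f a) (g b))
  end.

Definition iset_mem (x y : iset) := let: Sup B g := y in exists b, iset_eq x (g b).

Lemma iset_eq_refl x : iset_eq x x.
Proof. by elim: x => A f IH /=; split=> a; exists a. Qed.

Lemma iset_eq_sym x y : iset_eq x y -> iset_eq y x.
Proof.
elim: x y => A f IH [B g] /= [h1 h2].
by split=> [b|a]; [have [a /IH] := h2 b; exists a|have [b /IH] := h1 a; exists b].
Qed.

Lemma iset_eq_trans x y z : iset_eq x y -> iset_eq y z -> iset_eq x z.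
Proof.
elim: x y z => A f IH [B g] [C h] /= [h1 h2] [k1 k2].
split=> [a|c].
  by have [b ab] := h1 a; have [c bc] := k1 b; exists c; apply: IH ab bc.
by have [b bc] := k2 c; have [a ab] := h2 b; exists a; apply: IH ab bc.
Qed.

Lemma iset_mem_eq x y y' : iset_eq y y' -> iset_mem x y -> iset_mem x y'.
Proof.
case: y y' => [A f] [B g] /= [h _] [a xa]; have [b ab] := h a.
by exists b; apply: iset_eq_trans xa ab.
Qed.

(** Aczel's trees, with bisimilar ones identified through canonical representatives. *)
Lemma ex_small_universe : exists S : structure, [/\ models_KP S, wf S &
  forall (A : Set) (g : A -> S), exists s, forall x, x ∈ s <-> exists a, x = g a].
Proof.
have [c [c1 c2]] := canonical_representatives (Sup (fun a : Empty_set => match a with end))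
  iset_eq_refl iset_eq_sym iset_eq_trans.
have cc x : c (c x) = c x by symmetry; apply: c2.
pose S := @Structure {x | c x = x} (fun x y => iset_mem (sval x) (sval y)).
pose mk x : S := exist (fun x => c x = x) (c x) (cc x).
have mkE x y : iset_eq x y -> mk x = mk y by move=> /c2 xy; apply: eq_exist.
have mk_sval (x : S) : mk (sval x) = x by case: x => x hx; apply: eq_exist.
have sval_eq (x y : S) : iset_eq (sval x) (sval y) -> x = y.
  by rewrite -{2}[x]mk_sval -{2}[y]mk_sval => /mkE.
have small (s : S) : exists p : {A : Set & A -> S}, forall x, x ∈ s <->
    exists a, x = projT2 p a.
  case: s => -[A f] hs; exists (existT (fun A : Set => A -> S) A (mk \o f)) => x /=.
  split=> [[a xa]|[a ->]]; exists a; last exact/iset_eq_sym/c1.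
  by apply: sval_eq; apply: iset_eq_trans xa (c1 _).
have sup (A : Set) (g : A -> S) : exists s, forall x, x ∈ s <-> exists a, x = g a.
  exists (mk (Sup (fun a => sval (g a)))) => x; split.
    by move=> /(iset_mem_eq (iset_eq_sym (c1 _)))[a /sval_eq]; exists a.
  move=> [a ->]; apply: (iset_mem_eq (c1 _)); exists a; exact: iset_eq_refl.
have wfS : wf S.
  suff H v (x : S) : iset_eq (sval x) v -> Acc (@mem_in S) x.
    by move=> x; apply: H (iset_eq_refl _).
  elim: v x => A f IH x xv; constructor => y /(iset_mem_eq xv)[a]; exact: IH.
exists S; split=> //; apply: models_KP_of_small_sets => // x y xy; apply: sval_eq.
move: xy; case: x y => -[A f] hx [[B g] hy] /= xy.
split=> [a|b].
  have [b ab] : iset_mem (sval (mk (f a))) (Sup g).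
    by apply/xy; exists a; apply/iset_eq_sym/c1.
  by exists b; apply: iset_eq_trans ab; apply: c1.
have [a ab] : iset_mem (sval (mk (g b))) (Sup f).
  by apply/xy; exists b; apply/iset_eq_sym/c1.
by exists a; apply: iset_eq_sym; apply: iset_eq_trans ab; apply: c1.
Qed.

Lemma sub_structure_embeddable (S : structure) (H : set S) : embeddable (sub_structure H) S.
Proof.
by exists (fun x : sub_structure H => sval x); split=> // -[x hx] [y hy] /= xy; apply: eq_exist.
Qed.

Lemma ill_founded_countable_KP : exists N : structure,
  [/\ models_KP N, countable [set: N] & ~ wf N].
Proof.
have [S [KPS _ _]] := ex_small_universe.
have /choice[s hs] (x : S) : exists y, x ∈ y.
  by have [y [xy _]] := KP_pairing KPS x x; exists y.
have [x0] := KP_nonempty KPS.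
have [N KPN [g hg]] := ill_founded_KP (z := fun n => iter n s x0) KPS (fun n => hs _).
have [H [KPH cH gH]] := countable_KP_hull g KPN.
exists (sub_structure H); split=> // wH.
by apply: (@wf_no_descent _ (fun n => exist H (g n) (gH n) : sub_structure H) wH).
Qed.

Lemma ex_collapse (S A : structure) (x0 : S) (c : A -> nat) :
  (forall (B : Set) (g : B -> S), exists s, forall x, x ∈ s <-> exists b, x = g b) ->
  injective c -> wf A ->
  exists pi : A -> S, forall x z, z ∈ pi x <-> exists2 u, u ∈ x & z = pi u.
Proof.
move=> sup cI wfA.
apply: (@well_founded_choice A S (@mem_in A) x0
    (fun x f y => forall z, z ∈ y <-> exists2 u, u ∈ x & z = f u) wfA).
  move=> x f g y fg h z; rewrite h.
  by split=> -[u ux ->]; exists u => //; rewrite fg.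
move=> x f _.
(* The carrier of [A] lies in [Type], so the members of [x] are indexed by their codes, which form a
   type in [Set]. *)
have /choice[h hh] (k : {k : nat | exists u, u ∈ x /\ c u = k}) :
    exists u, u ∈ x /\ c u = sval k by case: k.
have [s hs] := sup _ (f \o h); exists s => z; rewrite hs; split=> [[k ->]|[u ux ->]].
  by exists (h k) => //; have [] := hh k.
have hu : exists u', u' ∈ x /\ c u' = c u by exists u.
exists (exist _ (c u) hu) => /=.
by have [_ /= /cI ->] := hh (exist _ (c u) hu).
Qed.

(** All [A n] are collapsed into one universe and their images gathered into a set [top]. A hull
    containing [top] and these images is higher than every [A n]. *)
Lemma ex_higher_model (A : nat -> structure) :
  (forall n, countable [set: A n]) -> (forall n, wf (A n)) ->
  exists N : structure, [/\ models_KP N, countable [set: N], wf N &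
    forall n, ~ height_le N (A n)].
Proof.
move=> cA wfA; have [S [KPS wfS sup]] := ex_small_universe.
have [x0] := KP_nonempty KPS.
pose c n := sval (cid (countable_inj (cA n))).
have cI n : injective (c n) := svalP (cid (countable_inj (cA n))).
pose pi n := sval (cid (ex_collapse x0 sup (@cI n) (wfA n))).
have hpi n : forall x z, z ∈ pi n x <-> exists2 u, u ∈ x & z = pi n u :=
  svalP (cid (ex_collapse x0 sup (@cI n) (wfA n))).
have /choice[b hb] (k : nat) : exists v : S, forall n x,
    k = pickle (n, c n x) -> v = pi n x.
  have [[n [x kx]]|h] := pselect (exists n x, k = pickle (n, c n x)); last first.
    by exists x0 => n x kx; case: h; exists n, x.
  exists (pi n x) => n' x'; rewrite kx => /(pcan_inj pickleK)[e].
  by subst n' => /cI ->.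
have [top htop] := sup nat b.
have [H [KPH cH aH]] := countable_KP_hull (fun n => if n is k.+1 then b k else top) KPS.
have piH n x : H (pi n x) by have := aH (pickle (n, c n x)).+1; rewrite /= (hb _ n x).
have wfH := wf_embeddable (sub_structure_embeddable H) wfS.
exists (sub_structure H); split=> // n hN.
have [x hx] := hN (exist _ top (aH 0)).
pose y : sub_structure H := exist _ (pi n x) (piH n x).
apply: (@rank_lt_irr _ (exist _ top (aH 0) : sub_structure H) y wfH).
  by apply/htop; exists (pickle (n, c n x)); rewrite (hb _ n x).
apply: rank_le_trans hx _.
(* The collapse is itself a simulation, so the rank of [x] is at most that of [pi n x], an element
   of [top]. *)
exists (fun a (v : sub_structure H) => sval v = pi n a) => // a v va a' aa'.
exists (exist _ (pi n a') (piH n a')) => //.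
by change (pi n a' ∈ sval v); rewrite va; apply/hpi; exists a'.
Qed.

(** * The order of the bi-embeddability classes *)

Lemma embeddable_refl (M : structure) : embeddable M M.
Proof. by exists id; split=> // x y. Qed.

Lemma embeddable_trans (M N P : structure) :
  embeddable M N -> embeddable N P -> embeddable M P.
Proof.
move=> [j [jI hj]] [k [kI hk]]; exists (k \o j); split; first exact: inj_comp.
by move=> x y; rewrite hj hk.
Qed.

Lemma model_embeddable_wf (M N : countable_model) : wf M -> wf N ->
  height_le M N -> embeddable M N.
Proof.
by apply: embeddable_wf; [apply: model_KP|apply: model_KP|apply: model_countable].
Qed.

Lemma model_embeddable_ill_founded (M N : countable_model) : ~ wf N -> embeddable M N.
Proof.
by apply: embeddable_ill_founded; [apply: model_KP|apply: model_KP|apply: model_countable].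
Qed.

Lemma model_embeddable_total (M N : countable_model) :
  embeddable M N \/ embeddable N M.
Proof. by apply: embeddable_total; try apply: model_KP; apply: model_countable. Qed.

(* By totality this implies [embeddable M N]. *)
Definition strictly_embeds (M N : countable_model) := ~ embeddable N M.

Lemma strictly_embeds_wf (M N : countable_model) : strictly_embeds M N -> wf M.
Proof.
move=> nNM; apply: contrapT => nwM; apply: nNM.
exact: model_embeddable_ill_founded.
Qed.

(** A model strictly below a well-founded [M] has height bounded by an element of [M], and going
    strictly down again moves this bound to one of its members. Only well-founded models lie
    strictly below another. *)
Lemma well_founded_strictly_embeds : well_founded strictly_embeds.
Proof.
have below (M0 : countable_model) : wf M0 -> forall (x : M0) (N : countable_model), wf N ->
    (forall y : N, exists2 x', x' ∈ x & rank_le y x') -> Acc strictly_embeds N.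
  move=> wf0; elim/(well_founded_ind wf0) => x IH N wfN hN.
  constructor=> N' N'N; have wfN' := strictly_embeds_wf N'N.
  have [|y hy] := @height_leN N N' wfN; first by move=> /(model_embeddable_wf wfN wfN') /N'N.
  have [x' x'x yx'] := hN y; apply: (IH x') => // y'.
  have [y'' y''y y'y''] := hy y'.
  have [x'' x''x' y''x''] := (rank_leP _ _).1 yx' _ y''y.
  by exists x'' => //; apply: rank_le_trans y'y'' y''x''.
have acc_wf (M : countable_model) : wf M -> Acc strictly_embeds M.
  move=> wfM; constructor=> N NM; have wfN := strictly_embeds_wf NM.
  have [|x hx] := @height_leN M N wfM; first by move=> /(model_embeddable_wf wfM wfN) /NM.
  exact: (below M wfM x).
by move=> M; constructor=> N /strictly_embeds_wf; apply: acc_wf.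
Qed.

Definition cls (M : countable_model) : biembed_classes :=
  exist _ (biembed_class M) (ex_intro2 _ _ M I erefl).

Definition rep (C : biembed_classes) : countable_model := sval (cid2 (svalP C)).

Lemma sval_rep C : biembed_class (rep C) = sval C.
Proof. by rewrite /rep; case: cid2. Qed.

Lemma biembeddable_eq (M N : countable_model) : biembeddable M N ->
  biembed_class M = biembed_class N.
Proof.
move=> [MN NM]; apply/seteqP; split=> P [h k]; split;
  by [apply: embeddable_trans h|apply: embeddable_trans k _].
Qed.

Lemma clsK C : cls (rep C) = C.
Proof. by case: C => C hC; apply: eq_exist; rewrite sval_rep. Qed.

Lemma rep_cls (M : countable_model) : biembeddable M (rep (cls M)).
Proof.
have /= E := sval_rep (cls M).
have : biembed_class (rep (cls M)) M by rewrite E; split; apply: embeddable_refl.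
by case.
Qed.

Lemma class_leE C D : class_le C D = `[< embeddable (rep C) (rep D) >].
Proof.
apply: asbool_equiv_eq; split=> [[M [N []]]|CD].
  rewrite -!sval_rep => -[CM _] [_ ND] MN.
  exact: embeddable_trans CM (embeddable_trans MN ND).
by exists (rep C), (rep D); rewrite -!sval_rep; split=> //; split; apply: embeddable_refl.
Qed.

Lemma rep_inj C D : biembeddable (rep C) (rep D) -> C = D.
Proof.
rewrite -[C]clsK -[D]clsK => CD; apply: eq_exist.
by apply: biembeddable_eq; rewrite !clsK in CD *.
Qed.

(** As [strictly_embeds] negates the converse embedding, a minimal representative is already a
    minimum. *)
Lemma class_le_well_order : well_order class_le.
Proof.
move=> A [C0 AC0]; have [C AC hC] : exists2 C, C \in A &
    forall D, D \in A -> ~ strictly_embeds (rep D) (rep C).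
  move: AC0; move: {2}(rep C0) (erefl (rep C0)) => M.
  elim/(well_founded_ind well_founded_strictly_embeds): M C0 => M IH C0 e AC0.
  have [[D [AD DC]]|h] := pselect (exists D, D \in A /\ strictly_embeds (rep D) (rep C0)).
    by apply: (IH (rep D) _ D) => //; rewrite -e.
  by exists C0 => // D AD DC; apply: h; exists D.
have min : minimum_of class_le A C.
  split=> // D AD; rewrite class_leE; apply/asboolP.
  by apply: contrapT => h; apply: (hC D AD).
exists C; split=> // D [AD minD].
apply: rep_inj; split; apply/asboolP; rewrite -class_leE.
  by case: min => _; apply.
exact: minD.
Qed.

Lemma well_order_injective (W T : Type) (f : W -> T) (le : rel T) :
  injective f -> well_order le -> well_order (fun v w => le (f v) (f w)).
Proof.
move=> fI hle A [w0 Aw0].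
have [|t [[/asboolP[w Aw <-] mint] ut]] := hle (fun t => `[< exists2 w, w \in A & f w = t >]).
  by exists (f w0); apply/asboolP; exists w0.
exists w; split; first by split=> // v Av; apply: mint; apply/asboolP; exists v.
move=> v [Av minv]; apply: fI; apply: ut; split; first by apply/asboolP; exists v.
by move=> t2 /asboolP[u Au <-]; apply: minv.
Qed.

Definition wf_class : Type := {C : biembed_classes | wf (rep C)}.

Definition wf_class_le : rel wf_class := fun v w => class_le (sval v) (sval w).

Lemma sval_wf_inj : injective (sval : wf_class -> biembed_classes).
Proof. by move=> [C hC] [D hD] /= CD; apply: eq_exist. Qed.

Lemma biembeddable_wf (M N : structure) : biembeddable M N -> wf M -> wf N.
Proof. by move=> [_ NM]; apply: wf_embeddable. Qed.

(** Diagonalization: a model higher than all representatives in an enumeration has a class missing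
    from it. *)
Lemma uncountable_wf_class : ~ countable [set: wf_class].
Proof.
move=> /countable_inj[c cI].
have /choice[A hA] (k : nat) : exists S : structure, [/\ countable [set: S], wf S &
    forall w : wf_class, c w = k -> S = rep (sval w)].
  have [[w wk]|h] := pselect (exists w, c w = k).
    exists (rep (sval w)); split; [exact: model_countable|exact: (svalP w)|].
    by move=> w'; rewrite -wk => /cI ->.
  (* The empty structure fills the indices that code no class. *)
  exists (@Structure Empty_set (fun _ _ => False)); split.
  - by apply/countable_injP; exists (fun=> 0) => -[].
  - by case.
  - by move=> w wk; case: h; exists w.
have [N [KPN cN wfN hN]] := ex_higher_model
  (fun n => let: And3 h _ _ := hA n in h) (fun n => let: And3 _ h _ := hA n in h).
pose M := CountableModel KPN cN.
have MC : biembeddable M (rep (cls M)) := rep_cls M.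
pose w : wf_class := exist _ (cls M) (biembeddable_wf MC wfN).
apply: (hN (c w)); have [_ _ /(_ w erefl) ->] := hA (c w).
by have [h _] := MC; apply: embeddable_height h.
Qed.

(** A class below [w] is coded by an element of the representative of [w] whose rank is exactly the
    height of that class. *)
Lemma countable_wf_class_below (w : wf_class) :
  countable [set v : wf_class | wf_class_le v w /\ v <> w].
Proof.
set M := rep (sval w); have wfM : wf M := svalP w.
have [c cI] := countable_inj (model_countable M).
have /choice[f hf] (v : wf_class) : exists n, wf_class_le v w /\ v <> w ->
    exists x : M, [/\ c x = n, forall y : rep (sval v), exists2 x', x' ∈ x & rank_le y x' &
      forall x', x' ∈ x -> exists y : rep (sval v), rank_le x' y].
  have [[vw nvw]|] := pselect (wf_class_le v w /\ v <> w); last by exists 0.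
  have wfN : wf (rep (sval v)) := svalP v.
  have [|x hx] := @height_leN M (rep (sval v)) wfM.
    move=> /(model_embeddable_wf wfM wfN) wv; apply/nvw/sval_wf_inj/rep_inj; split=> //.
    by apply/asboolP; rewrite -class_leE.
  (* An ∈-minimal bound has no member that is still a bound, which makes its rank the exact
     height. *)
  elim/(well_founded_ind wfM): x hx => x IH hx.
  have [[x' [x'x hx']]|h] := pselect (exists x', x' ∈ x /\
      forall y : rep (sval v), exists2 x'', x'' ∈ x' & rank_le y x'').
    exact: IH hx'.
  exists (c x) => _; exists x; split=> // x' x'x.
  apply: contrapT => hy; apply: h; exists x'; split=> // y.
  by case: (rank_le_total x' y wfM) => // le; case: hy; exists y.
apply/countable_injP; exists f => v v' /set_mem vw /set_mem v'w ff.
have [x [fx x1 x2]] := hf v vw; have [x' [fx' x1' x2']] := hf v' v'w.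
have ? : x = x' by apply: cI; rewrite fx fx'.
subst x'; apply/sval_wf_inj/rep_inj.
have half (u u' : wf_class) :
    (forall y : rep (sval u), exists2 x', x' ∈ x & rank_le y x') ->
    (forall x', x' ∈ x -> exists y : rep (sval u'), rank_le x' y) ->
    embeddable (rep (sval u)) (rep (sval u')).
  move=> h1 h2; apply: model_embeddable_wf; [exact: (svalP u)|exact: (svalP u')|].
  move=> y; have [x' x'x yx'] := h1 y; have [y' x'y'] := h2 _ x'x.
  by exists y'; apply: rank_le_trans yx' x'y'.
by split; apply: half.
Qed.

Lemma class_le_order_type : has_order_type_omega1_plus_1 class_le.
Proof.
exists wf_class, wf_class_le; split.
  split; [|exact: uncountable_wf_class|exact: countable_wf_class_below].
  exact: well_order_injective sval_wf_inj class_le_well_order.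
have [I0 [KPI cI nwfI]] := ill_founded_countable_KP.
pose top := cls (CountableModel KPI cI).
have ntop : ~ wf (rep top).
  by move=> h; apply: nwfI; apply: wf_embeddable h; case: (rep_cls (CountableModel KPI cI)).
pose f C : option wf_class :=
  if pselect (wf (rep C)) is left h then Some (exist _ C h) else None.
exists f; split.
  (* [None] goes to [top], the only ill-founded class, since ill-founded models embed into each
     other. *)
  exists (fun o => if o is Some w then sval w else top) => [C|[[C hC]|]]; rewrite /f.
  - case: pselect => //= nC; apply: rep_inj.
    by split; apply: model_embeddable_ill_founded.
  - by case: pselect => //= h; congr Some; apply: eq_exist.
  - by case: pselect.
move=> C D; rewrite /f; case: pselect => hC; case: pselect => hD //=.
- by rewrite class_leE; apply/asboolP/model_embeddable_ill_founded.
- by rewrite class_leE; apply/asboolP => CD; apply: hC; apply: wf_embeddable CD hD.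
- by rewrite class_leE; apply/asboolP/model_embeddable_ill_founded.
Qed.

Theorem theorem2 :
  [/\ forall M N : structure,
        models_KP M -> models_KP N ->
        countable [set: M] -> countable [set: N] ->
        embeddable M N \/ embeddable N M,
      wochoice.preorder embeds /\ total embeds,
      wochoice.well_order class_le &
      has_order_type_omega1_plus_1 class_le].
Proof.
split.
- exact: embeddable_total.
- split; first split.
  + by move=> M; apply/asboolP/embeddable_refl.
  + move=> N M P /asboolP MN /asboolP NP.
    by apply/asboolP; apply: embeddable_trans MN NP.
  + move=> M N; apply/orP; have [?|?] := model_embeddable_total M N.
      by left; apply/asboolP.
    by right; apply/asboolP.
- exact: class_le_well_order.
- exact: class_le_order_type.
Qed.
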